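(* Let $\mathcal G_\bullet$ be a (coherent) Lie 2-group whose underlying Lie groupoid is an action groupoid $H\ltimes G\rightrightarrows G$, let $(V,\zeta:H\to\mathrm{Aut}(V))$ be a representation of the Lie group $H$, and let $C_V:=\mathrm{Fun}(\mathcal G_\bullet,\{V\}/\zeta(H))$. Then the following data define a 2-representation $\mathcal F_V=(f_V,f_V^2,f_V^0):B\mathcal G_\bullet\to2\mathsf{Vect}$ of $\mathcal G_\bullet$: (i) the unique object $*$ of $B\mathcal G_\bullet$ is sent to $C_V$; (ii) each $g\in G$ is sent to the functor $f_{V,g}:C_V\to C_V$ with $f_{V,g}(\rho):x\mapsto\rho(x\circ_hg)$, $(x\xrightarrow{b}y)\mapsto\rho(b\cdot_h1_g)$, and, for a morphism $f:\rho\Rightarrow\rho'$ of $C_V$, $f_{V,g}(f)_x=f_{x\circ_hg}$; (iii) each arrow $g_1:g_0\to g_0'$ of $\mathcal G_\bullet$ is sent to the natural transformation $f_{V,g_1}:f_{V,g_0}\Rightarrow f_{V,g_0'}$ with $f_{V,g_1}(\rho)_x=\rho(1_x\cdot_hg_1)$; (iv) the structure isomorphisms are $f^2_{V,(g,\hat g)}(\rho)_x=\rho(a_{x,g,\hat g}):(f_{V,g}\circ f_{V,\hat g})(\rho)(x)\to f_{V,g\circ_h\hat g}(\rho)(x)$ and $f^0_V(\rho)_x=\rho(r_x)^{-1}:\rho(x)\to f_{V,I}(\rho)(x)$.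
   Context: $k$ is a field of characteristic zero (typically $\mathbb R$ or $\mathbb C$). A coherent Lie 2-group $\mathcal G_\bullet=(\mathcal G_1\rightrightarrows\mathcal G_0)$ is a group object in the bicategory of Lie groupoids: a Lie groupoid with a multiplication $m:\mathcal G_\bullet\times\mathcal G_\bullet\to\mathcal G_\bullet$ and unit $u:*\to\mathcal G_\bullet$ (write $I=u( * )$) such that $(\mathrm{pr}_1,m)$ is an equivalence, together with invertible 2-morphisms $a:m\circ(m\times1)\Rightarrow m\circ(1\times m)$, $l:m\circ(u\times1)\Rightarrow1$, $r:m\circ(1\times u)\Rightarrow1$ satisfying the pentagon and triangle identities. Write $x\circ_hg=m(x,g)$ on objects, $b\cdot_hc=m(b,c)$ on arrows, $b\cdot_vc$ for composition of arrows, and $1_g$ for the identity arrow of $g$. $B\mathcal G_\bullet$ is the one-object bicategory with hom-category $\mathcal G_\bullet$ and horizontal composition $m$. $2\mathsf{Vect}$ is the strict 2-category of $k$-prelinear categories (hom-sets are $k$-vector spaces, composition $k$-bilinear), $k$-linear functors and natural transformations. A 2-representation of $\mathcal G_\bullet$ is a pseudofunctor $B\mathcal G_\bullet\to2\mathsf{Vect}$. Action groupoid: $H$ is a Lie group acting on $G$ from the left; $\mathcal G_0=G$, $\mathcal G_1=H\ltimes G$, $\mathsf s(h,g)=g$, $\mathsf t(h,g)=h\cdot g$, identities $(e,g)$, composition $(h_1,g_1)\cdot_v(h_2,g_2)=(h_1h_2,g_2)$. $\{V\}/\zeta(H)$ is the groupoid with one object $V$ and $\mathrm{Hom}(V,V)=\zeta(H)$.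 In $C_V=\mathrm{Fun}(\mathcal G_\bullet,\{V\}/\zeta(H))$ the symbol $\mathcal G_\bullet$ means the underlying Lie groupoid. The paper regards $C_V$ as a $k$-prelinear category, embedded fully faithfully in the category of representations of the Lie groupoid $\mathcal G_\bullet$ on trivial vector bundles by sending $\rho$ to the trivial bundle $G\times V$ with the action given by $\rho$. *)

(* Defs.v *)
From HB Require Import structures.
From mathcomp Require Import all_boot all_order all_algebra.
From mathcomp Require Import all_classical all_reals all_analysis.

Set Implicit Arguments.
Unset Strict Implicit.
Unset Printing Implicit Defensive.

Import Order.TTheory GRing.Theory Num.Theory.
Import numFieldNormedType.Exports.
Local Open Scope classical_set_scope.
Local Open Scope ring_scope.

(* C^k is defined through the tangent map: f is C^{k+1} on U iff f is
   differentiable on U and (x, v) |-> df_x(v) is C^k on U x E. *)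
Fixpoint Ck_on (R : realType) (k : nat) :
    forall E F : normedModType R, set E -> (E -> F) -> Prop :=
  match k with
  | 0%N => fun E F U f => forall x, U x -> {for x, continuous f}
  | k'.+1 => fun E F U f =>
      (forall x, U x -> differentiable f x) /\
      @Ck_on R k' (E * E)%type F (U `*` setT) (fun p => 'd f (p.1) p.2)
  end.

Definition smooth_on (R : realType) (E F : normedModType R) (U : set E)
  (f : E -> F) : Prop := forall k, Ck_on k U f.

Section Calculus.
Context {R : realType}.
Implicit Types E F H : normedModType R.

Lemma open_setX (S T : topologicalType) (A : set S) (B : set T) :
  open A -> open B -> open (A `*` B).
Proof.
move=> oA oB; rewrite openE => -[x y] [/= Ax By].
by exists (A, B) => //; split; apply: open_nbhs_nbhs.
Qed.

Lemma eq_near_differentiable E F (f g : E -> F) x :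
  {near x, f =1 g} -> differentiable f x ->
  differentiable g x /\ 'd g x = 'd f x :> (E -> F).
Proof.
move=> fg df; have fgx : f x = g x by apply: nbhs_singleton fg.
have key : g \o shift x = cst (g x) + 'd f x +o_ 0 id.
  apply/eqaddoP => eps e0.
  have /diff_locallyP[_ /eqaddoP/(_ eps e0) df'] := df.
  have fg0 : \forall y \near (0 : E), f (y + x) = g (y + x).
    move: fg; rewrite (near_shift 0 x) subr0 => fg.
    by apply: filterS fg => y /=.
  apply: filterS2 df' fg0 => y /=.
  by rewrite !fctE /= => + <-; rewrite fgx.
have dgf : 'd g x = 'd f x :> (E -> F) := diff_unique (diff_continuous df) key.
split; last exact: dgf.
apply/diff_locallyP; split; last by rewrite dgf; exact: key.
by rewrite dgf; exact: diff_continuous.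
Qed.

Lemma eq_near_continuous E F (f g : E -> F) x :
  {near x, f =1 g} -> {for x, continuous f} -> {for x, continuous g}.
Proof.
move=> fg cf A; rewrite /= -(nbhs_singleton fg) => /cf fA.
by apply: filterS2 fg fA => y /= ->.
Qed.

Lemma eq_Ck E F k (U : set E) (f g : E -> F) : open U ->
  (forall x, U x -> f x = g x) -> Ck_on k U f -> Ck_on k U g.
Proof.
elim: k E F U f g => [|k IH] E F U f g oU fg /=.
  move=> cf x Ux; apply: eq_near_continuous (cf x Ux).
  by apply: filterS fg _; exact: open_nbhs_nbhs.
move=> [df Cdf].
have dfg x : U x -> differentiable g x /\ 'd g x = 'd f x :> (E -> F).
  move=> Ux; apply: eq_near_differentiable (df x Ux).
  by apply: filterS fg _; exact: open_nbhs_nbhs.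
split=> [x /dfg[]//|].
apply: IH Cdf; first by apply: open_setX => //; exact: openT.
by move=> p [/dfg[_ e] _]; exact: (congr1 (@^~ p.2) (esym e)).
Qed.

Lemma Ck_local E F k (U : set E) (f : E -> F) :
  (forall x, U x -> exists2 W, W x & Ck_on k W f) -> Ck_on k U f.
Proof.
elim: k E F U f => [|k IH] E F U f UW /=.
  by move=> x /UW[W Wx]; apply.
split=> [x /UW[W Wx [+ _]]|]; first exact.
apply: IH => -[x v] [/= /UW[W Wx [_ CW]] _].
by exists (W `*` setT).
Qed.

Lemma Ck_sub E F k (U W : set E) (f : E -> F) :
  U `<=` W -> Ck_on k W f -> Ck_on k U f.
Proof. by move=> UW CW; apply: Ck_local => x /UW Wx; exists W. Qed.

Lemma CkS E F k (U : set E) (f : E -> F) : Ck_on k.+1 U f -> Ck_on k U f.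
Proof.
elim: k E F U f => [|k IH] E F U f.
  by move=> [df _] x /df; exact: differentiable_continuous.
by move=> [df Cdf]; split=> //; exact: IH.
Qed.

Lemma Ck_lin E F k (U : set E) (f : {linear E -> F}) :
  continuous f -> Ck_on k U f.
Proof.
elim: k E F U f => [|k IH] E F U f cf; first by move=> x _; exact: cf.
split=> [x _|]; first exact: linear_differentiable.
have -> : (fun p : E * E => 'd f (p.1) p.2) = f \o snd.
  by apply/funext => p /=; rewrite diff_lin.
have -> : f \o snd = (f \o (snd : {linear (E * E)%type -> E})) by [].
by apply: IH => p; apply: continuous_comp; [exact: cvg_snd|exact: cf].
Qed.

Lemma Ck_pair E F H k (U : set E) (f : E -> F) (g : E -> H) : open U ->
  Ck_on k U f -> Ck_on k U g -> Ck_on k U (fun x => (f x, g x)).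
Proof.
elim: k E F H U f g => [|k IH] E F H U f g oU /=.
  by move=> cf cg x Ux; apply: cvg_pair; [exact: cf|exact: cg].
move=> [df Cdf] [dg Cdg]; split=> [x Ux|].
  by apply: differentiable_pair; [exact: df|exact: dg].
have oUT : open (U `*` [set: E]) by apply: open_setX => //; exact: openT.
apply: eq_Ck (IH _ _ _ _ _ _ oUT Cdf Cdg) => // -[x v] [/= Ux _].
by rewrite diff_pair; [|exact: df|exact: dg].
Qed.

Lemma Ck_comp E F H k (U : set E) (W : set F) (f : E -> F) (g : F -> H) :
  open U -> (forall x, U x -> W (f x)) ->
  Ck_on k U f -> Ck_on k W g -> Ck_on k U (g \o f).
Proof.
elim: k E F H U W f g => [|k IH] E F H U W f g oU UW.
  move=> cf cg x Ux; apply: continuous_comp; first exact: cf.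
  exact/cg/UW.
move=> Cf [dg Cdg]; have [df Cdf] := Cf; split=> [x Ux|].
  by apply: differentiable_comp; [exact: df|exact/dg/UW].
have oUT : open (U `*` [set: E]) by apply: open_setX => //; exact: openT.
have Cfst : Ck_on k (U `*` [set: E]) (f \o fst).
  apply: (IH _ _ _ _ U) => //; [by move=> ? []| |exact: CkS].
  by apply: (@Ck_lin _ _ _ _ (fst : {linear (E * E)%type -> E})) => p; exact: cvg_fst.
apply: eq_Ck (IH _ _ _ _ _ _ _ oUT _ (Ck_pair oUT Cfst Cdf) Cdg) => //=.
  by move=> -[x v] [/= Ux _]; rewrite (diff_comp (df _ Ux) (dg _ (UW _ Ux))).
by move=> -[x v] [/= Ux _]; split=> //; exact: UW.
Qed.

Lemma Ck_cst E F k (U : set E) (a : F) : Ck_on k U (fun=> a).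
Proof.
elim: k E F U a => [|k IH] E F U a; first by move=> x _; exact: cvg_cst.
split=> [x _|]; first exact: differentiable_cst.
have -> : (fun p : E * E => 'd (cst a) (p.1) p.2) = fun=> 0 :> F.
  by apply/funext => p; rewrite diff_cst.
exact: IH.
Qed.

End Calculus.

(* A smooth structure on a set is given by an atlas; the topology is the one
   for which the charts are homeomorphisms onto open subsets of R^n (see
   [mopen]).  [cof] is only meaningful on the image of [cdom]. *)
Record chart (R : realType) (n : nat) (T : Type) := Chart {
  cdom : set T;
  cto : T -> 'rV[R]_n;
  cof : 'rV[R]_n -> T;
  ctoK : forall x, cdom x -> cof (cto x) = x }.

Record smooth_structure (R : realType) (T : Type) := SmoothStructure {
  mdim : nat;
  charts : set (chart R mdim T);
  charts_cover : forall x, exists2 c, charts c & cdom c x;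
  charts_compat : forall c d, charts c -> charts d ->
    let D := cto c @` (cdom c `&` cdom d) in
    open D /\ smooth_on D (cto d \o cof c) }.

Arguments charts {R T} s.
Arguments charts_cover {R T} s x.

Definition smooth_map (R : realType) (S T : Type) (M : smooth_structure R S)
    (N : smooth_structure R T) (f : S -> T) : Prop :=
  forall (c : chart R (mdim M) S) (d : chart R (mdim N) T),
    charts M c -> charts N d ->
    let D := cto c @` (cdom c `&` f @^-1` cdom d) in
    open D /\ smooth_on D (cto d \o f \o cof c).

Definition submersion (R : realType) (S T : Type) (M : smooth_structure R S)
    (N : smooth_structure R T) (f : S -> T) : Prop :=
  smooth_map M N f /\
  forall c d x, charts M c -> charts N d -> cdom c x -> cdom d (f x) ->
    forall w, exists v, 'd (cto d \o f \o cof c) (cto c x) v = w.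

Definition mopen (R : realType) (T : Type) (M : smooth_structure R T)
    (A : set T) : Prop :=
  forall c, charts M c -> open (cto c @` (cdom c `&` A)).

(* Hausdorff and second countable; for a locally Euclidean space the latter
   means that countably many charts suffice to cover. *)
Definition is_manifold (R : realType) (T : Type) (M : smooth_structure R T)
    : Prop :=
  (forall x y, x <> y -> exists A B, [/\ mopen M A, mopen M B, A x, B y &
     A `&` B = set0]) /\
  (exists C, [/\ countable C, C `<=` charts M &
     forall x, exists2 c, C c & cdom c x]).

Section SmoothMaps.
Context {R : realType}.

Lemma imageP n T (c : chart R n T) (A : set T) u :
  (cto c @` (cdom c `&` A)) u <->
  [/\ cdom c (cof c u), A (cof c u) & cto c (cof c u) = u].
Proof.
split=> [[x [cx Ax] <-]|[cu Au e]]; first by rewrite ctoK.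
by exists (cof c u).
Qed.

Lemma open_preimage_on (E F : normedModType R) (U : set E) (V : set F)
  (f : E -> F) : open U -> open V -> (forall x, U x -> {for x, continuous f}) ->
  open (U `&` f @^-1` V).
Proof.
move=> oU oV cf; rewrite openE => x [Ux Vfx].
apply: filterI; first exact: open_nbhs_nbhs.
by apply: cf => //; exact: open_nbhs_nbhs.
Qed.

Section Comp.
Context {S T U : Type} {M : smooth_structure R S} {N : smooth_structure R T}
  {P : smooth_structure R U}.

Lemma smooth_comp (g : T -> U) (f : S -> T) :
  smooth_map N P g -> smooth_map M N f -> smooth_map M P (g \o f).
Proof.
move=> sg sf c e Mc Pe D.
have W u : D u -> exists W : set 'rV[R]_(mdim M),
    [/\ open W, W u, W `<=` D & smooth_on W (cto e \o (g \o f) \o cof c)].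
  move=> /imageP[/= cu eu uE].
  have [d Nd du] := charts_cover N (f (cof c u)).
  have [oDf Cf] := sf _ _ Mc Nd; have [oDg Cg] := sg _ _ Nd Pe.
  set Df := cto c @` _ in oDf Cf; set Dg := cto d @` _ in oDg Cg.
  pose W := Df `&` (cto d \o f \o cof c) @^-1` Dg.
  have WP v : W v -> [/\ cdom c (cof c v), cdom d (f (cof c v)),
      cdom e (g (f (cof c v))) & cto c (cof c v) = v].
    move=> [/imageP[/= cv dv vE] /imageP[/= _ ev _]].
    by split=> //; move: ev; rewrite ctoK.
  have oW : open W by apply: (open_preimage_on oDf oDg) => v; exact: (Cf 0%N).
  exists W; split=> //.
  - split; first by apply/imageP.
    by apply/imageP => /=; rewrite !ctoK.
  - by move=> v /WP[cv _ ev vE]; apply/imageP.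
  - move=> k; apply: (@eq_Ck _ _ _ _ _ ((cto e \o g \o cof d) \o (cto d \o f \o cof c))) => //.
      by move=> v /WP[_ dv _ _] /=; rewrite ctoK.
    apply: (Ck_comp oW _ _ (Cg k)); first by move=> v [].
    by apply: Ck_sub (Cf k) => v [].
split.
  rewrite openE => u /W[Wu [oW Wuu WD _]].
  by apply: filterS WD _; exact: open_nbhs_nbhs.
by move=> k; apply: Ck_local => u /W[Wu [_ Wuu _ Ck]]; exists Wu.
Qed.

Lemma smooth_id : smooth_map M M id.
Proof. by move=> c d Mc Md; exact: (charts_compat Mc Md). Qed.

Lemma mopen_dom c : charts M c -> open (cto c @` cdom c).
Proof. by move=> Mc; have [] := charts_compat Mc Mc; rewrite setIid. Qed.

Lemma smooth_cst (a : T) : smooth_map M N (fun=> a).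
Proof.
move=> c d Mc Nd; split; last by move=> k; exact: Ck_cst.
have [da|nda] := pselect (cdom d a).
  by rewrite (_ : _ `&` _ = cdom c) ?eqEsubset; [exact: mopen_dom|split=> [?[]|]].
by rewrite (_ : _ `&` _ = set0) ?image_set0 -?subset0; [exact: open0|move=> ?[]].
Qed.

End Comp.

Lemma continuous_row_mx m n :
  continuous (fun p : 'rV[R]_m * 'rV[R]_n => row_mx p.1 p.2).
Proof.
move=> [u v] A [P uvP PA].
exists ([set x : 'rV_m | forall i j, P i (lshift n j) (x i j)],
        [set y : 'rV_n | forall i j, P i (rshift m j) (y i j)]).
  split=> /=.
    exists (fun i j => P i (lshift n j)) => // i j.
    by move: (uvP i (lshift n j)); rewrite /= row_mxEl.
  exists (fun i j => P i (rshift m j)) => // i j.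
  by move: (uvP i (rshift m j)); rewrite /= row_mxEr.
move=> [x y] [/= xP yP]; apply: PA => i j.
by case: (split_ordP j) => k ->; rewrite /= ?row_mxEl ?row_mxEr.
Qed.

Lemma row_mx_linear m n :
  linear (fun p : 'rV[R]_m * 'rV[R]_n => row_mx p.1 p.2).
Proof. by move=> a p q; rewrite /= scale_row_mx add_row_mx. Qed.

Lemma Ck_row_mx (E : normedModType R) m n k (U : set E) (f : E -> 'rV[R]_m)
    (g : E -> 'rV[R]_n) : open U ->
  Ck_on k U f -> Ck_on k U g -> Ck_on k U (fun x => row_mx (f x) (g x)).
Proof.
move=> oU Cf Cg.
pose L : {linear ('rV[R]_m * 'rV[R]_n)%type -> 'rV[R]_(m + n)} :=
  HB.pack (fun p : 'rV[R]_m * 'rV[R]_n => row_mx p.1 p.2)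
    (GRing.isLinear.Build _ _ _ _ _ (@row_mx_linear m n)).
have -> : (fun x => row_mx (f x) (g x)) = L \o (fun x => (f x, g x)) by [].
apply: (Ck_comp oU _ (Ck_pair oU Cf Cg) (Ck_lin _ setT _)) => //.
exact: continuous_row_mx.
Qed.

Lemma Ck_lsubmx k m n (U : set 'rV[R]_(m + n)) : Ck_on k U lsubmx.
Proof. by apply: Ck_lin; exact: continuous_lsubmx. Qed.

Lemma Ck_rsubmx k m n (U : set 'rV[R]_(m + n)) : Ck_on k U rsubmx.
Proof. by apply: Ck_lin; exact: continuous_rsubmx. Qed.

Lemma transition_surj T (N : smooth_structure R T) d d' y :
  charts N d -> charts N d' -> cdom d y -> cdom d' y -> forall w,
  differentiable (cto d' \o cof d) (cto d y) /\
  exists v, 'd (cto d' \o cof d) (cto d y) v = w.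
Proof.
move=> Nd Nd' dy d'y w.
have [_ /(_ 1%N)[dphi _]] := charts_compat Nd Nd'.
have [opsi /(_ 1%N)[dpsi _]] := charts_compat Nd' Nd.
have Dphi : differentiable (cto d' \o cof d) (cto d y) by apply: dphi; exists y.
have Dpsi : differentiable (cto d \o cof d') (cto d' y) by apply: dpsi; exists y.
split=> //; exists ('d (cto d \o cof d') (cto d' y) w).
have psiy : (cto d \o cof d') (cto d' y) = cto d y by rewrite /= ctoK.
have Dphi' : differentiable (cto d' \o cof d) ((cto d \o cof d') (cto d' y)).
  by rewrite psiy.
have := diff_comp Dpsi Dphi'; rewrite psiy => /(congr1 (@^~ w))/= <-.
have near_id : {near cto d' y, id =1 (cto d' \o cof d) \o (cto d \o cof d')}.
  have : nbhs (cto d' y) (cto d' @` (cdom d' `&` cdom d)).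
    by apply: open_nbhs_nbhs; split=> //; exists y.
  by apply: filterS => u /imageP[/= d'u du uE]; rewrite /= ctoK.
have cid : continuous (idfun : {linear 'rV[R]_(mdim N) -> 'rV[R]_(mdim N)}).
  by move=> ?; exact: cvg_id.
have [_ ->] := eq_near_differentiable near_id (linear_differentiable (cto d' y) cid).
by rewrite (diff_lin _ cid).
Qed.

Section Product.
Context {S T : Type}.

Definition chart_prod m n (c : chart R m S) (d : chart R n T) :
  chart R (m + n) (S * T).
Proof.
refine (@Chart R (m + n) (S * T) (cdom c `*` cdom d)
  (fun p => row_mx (cto c p.1) (cto d p.2))
  (fun u => (cof c (lsubmx u), cof d (rsubmx u))) _).
by move=> [x y] [/= cx dy]; rewrite row_mxKl row_mxKr !ctoK.
Defined.

Lemma image_chart_prod m n (c : chart R m S) (d : chart R n T) A B :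
  cto (chart_prod c d) @` (cdom (chart_prod c d) `&` (A `*` B)) =
  (lsubmx @^-1` (cto c @` (cdom c `&` A))) `&`
  (rsubmx @^-1` (cto d @` (cdom d `&` B))).
Proof.
apply/seteqP; split=> u.
  move=> [[x y] /= [[/= cx dy] [/= Ax By]] <-].
  by split; rewrite /= ?row_mxKl ?row_mxKr; [exists x|exists y].
move=> [/imageP[cx Ax ex] /imageP[dy By ey]]; apply/imageP; split=> //=.
by rewrite ex ey hsubmxK.
Qed.

Lemma open_chart_prod m n (A : set 'rV[R]_m) (B : set 'rV[R]_n) :
  open A -> open B -> open ((lsubmx @^-1` A) `&` (rsubmx @^-1` B)).
Proof.
move=> oA oB; apply: openI; apply: open_comp => // x _.
  exact: continuous_lsubmx.
exact: continuous_rsubmx.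
Qed.

Context (M : smooth_structure R S) (N : smooth_structure R T).

Definition prod_structure : smooth_structure R (S * T).
Proof.
refine (@SmoothStructure R (S * T) (mdim M + mdim N)
  [set e | exists c d, [/\ charts M c, charts N d & e = chart_prod c d]] _ _).
  move=> [x y]; have [c Mc cx] := charts_cover M x.
  have [d Nd dy] := charts_cover N y.
  by exists (chart_prod c d) => //; exists c, d.
move=> _ _ [c [d [Mc Nd ->]]] [c' [d' [Mc' Nd' ->]]] D.
have [oc Cc] := charts_compat Mc Mc'; have [od Cd] := charts_compat Nd Nd'.
have oD : open D by rewrite /D image_chart_prod; exact: open_chart_prod.
split=> // k; apply: Ck_row_mx => //.
  apply: (Ck_comp oD _ (Ck_lsubmx _ _) (Cc k)) => u.
  by rewrite /D image_chart_prod => -[].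
apply: (Ck_comp oD _ (Ck_rsubmx _ _) (Cd k)) => u.
by rewrite /D image_chart_prod => -[].
Defined.

Lemma mopen_fst (A : set S) : mopen M A -> mopen prod_structure (fst @^-1` A).
Proof.
move=> oA _ [c [d [Mc Nd ->]]].
have -> : (fst @^-1` A : set (S * T)) = A `*` setT.
  by apply/seteqP; split=> p // [].
rewrite image_chart_prod; apply: open_chart_prod; first exact: oA.
by rewrite setIT; exact: (mopen_dom Nd).
Qed.

Lemma mopen_snd (B : set T) : mopen N B -> mopen prod_structure (snd @^-1` B).
Proof.
move=> oB _ [c [d [Mc Nd ->]]].
have -> : (snd @^-1` B : set (S * T)) = setT `*` B.
  by apply/seteqP; split=> p // [].
rewrite image_chart_prod; apply: open_chart_prod; last exact: oB.
by rewrite setIT; exact: (mopen_dom Mc).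
Qed.

Lemma prod_is_manifold :
  is_manifold M -> is_manifold N -> is_manifold prod_structure.
Proof.
move=> [hM [CM [cCM CMM covM]]] [hN [CN [cCN CNN covN]]]; split.
  move=> [x y] [x' y'] xy.
  have [xx'|xx'] := pselect (x = x'); last first.
    have [A [B [oA oB Ax Bx' AB]]] := hM _ _ xx'.
    exists (fst @^-1` A), (fst @^-1` B).
    split=> //; [exact: mopen_fst|exact: mopen_fst|].
    by rewrite -preimage_setI AB preimage_set0.
  have /hN[A [B [oA oB Ax Bx' AB]]] : y <> y' by move=> yy'; apply: xy; rewrite xx' yy'.
  exists (snd @^-1` A), (snd @^-1` B).
  split=> //; [exact: mopen_snd|exact: mopen_snd|].
  by rewrite -preimage_setI AB preimage_set0.
exists ((fun cd => chart_prod cd.1 cd.2) @` (CM `*` CN)); split.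
- apply: (sub_countable (card_image_le _ _)); exact: countableX.
- by move=> _ [[c d] [/= /CMM Mc /CNN Nd] <-]; exists c, d.
- move=> [x y]; have [c Cc cx] := covM x; have [d Cd dy] := covN y.
  by exists (chart_prod c d) => //; exists (c, d).
Qed.

Lemma smooth_fst : smooth_map prod_structure M fst.
Proof.
move=> _ c' [c [d [Mc Nd ->]]] Mc' D.
have [oc Cc] := charts_compat Mc Mc'.
have eD : D = (lsubmx @^-1` (cto c @` (cdom c `&` cdom c'))) `&`
  (rsubmx @^-1` (cto d @` (cdom d `&` setT))).
  by rewrite -image_chart_prod; congr image; apply/seteqP; split=> -[x y] /= [[? ?]] // [].
have oD : open D.
  by rewrite eD; apply: open_chart_prod => //; rewrite setIT; exact: (mopen_dom Nd).
split=> // k.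
by apply: (Ck_comp oD _ (Ck_lsubmx _ _) (Cc k)) => u; rewrite eD => -[].
Qed.

Lemma smooth_snd : smooth_map prod_structure N snd.
Proof.
move=> _ d' [c [d [Mc Nd ->]]] Nd' D.
have [od Cd] := charts_compat Nd Nd'.
have eD : D = (lsubmx @^-1` (cto c @` (cdom c `&` setT))) `&`
  (rsubmx @^-1` (cto d @` (cdom d `&` cdom d'))).
  by rewrite -image_chart_prod; congr image; apply/seteqP; split=> -[x y] /= [[? ?]] // [].
have oD : open D.
  by rewrite eD; apply: open_chart_prod => //; rewrite setIT; exact: (mopen_dom Mc).
split=> // k.
by apply: (Ck_comp oD _ (Ck_rsubmx _ _) (Cd k)) => u; rewrite eD => -[].
Qed.

Lemma smooth_pair Q (P : smooth_structure R Q) (f : Q -> S) (g : Q -> T) :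
  smooth_map P M f -> smooth_map P N g ->
  smooth_map P prod_structure (fun x => (f x, g x)).
Proof.
move=> sf sg e _ Pe [c [d [Mc Nd ->]]] D.
have [oc Cc] := sf _ _ Pe Mc; have [od Cd] := sg _ _ Pe Nd.
have eD : D = (cto e @` (cdom e `&` f @^-1` cdom c)) `&`
    (cto e @` (cdom e `&` g @^-1` cdom d)).
  apply/seteqP; split=> u.
    by move=> /imageP[/= eu [/= cu du] ue]; split; apply/imageP.
  by move=> [/imageP[/= eu cu ue] /imageP[/= _ du _]]; apply/imageP.
have oD : open D by rewrite eD; exact: openI.
split=> // k; apply: Ck_row_mx => //.
  by apply: Ck_sub (Cc k); rewrite eD => u [].
by apply: Ck_sub (Cd k); rewrite eD => u [].
Qed.

Lemma submersion_snd : submersion prod_structure N snd.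
Proof.
split; first exact: smooth_snd.
move=> _ d' [x y] [c [d [Mc Nd ->]]] Nd' [/= cx dy] d'y w.
have [dphi [v vw]] := transition_surj Nd Nd' dy d'y w.
exists (row_mx 0 v).
have -> : cto d' \o snd \o (fun u => (cof c (lsubmx u), cof d (rsubmx u))) =
  (cto d' \o cof d) \o (rsubmx : 'rV[R]_(mdim M + mdim N) -> 'rV[R]_(mdim N)).
  by [].
rewrite diff_comp; [|exact: differentiable_rsubmx|by rewrite row_mxKr].
by rewrite /= (diff_lin _ (@continuous_rsubmx _ _ _ _)) /= !row_mxKr vw.
Qed.

End Product.
Arguments smooth_fst {S T} M N.
Arguments smooth_snd {S T} M N.

Lemma submersion_prod S T S' T' (M : smooth_structure R S)
    (N : smooth_structure R T) (M' : smooth_structure R S')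
    (N' : smooth_structure R T') (f : S -> S') (g : T -> T') :
  submersion M M' f -> submersion N N' g ->
  submersion (prod_structure M N) (prod_structure M' N')
    (fun p => (f p.1, g p.2)).
Proof.
move=> [sf subf] [sg subg]; split.
  apply: smooth_pair.
    exact: (smooth_comp sf (smooth_fst M N)).
  exact: (smooth_comp sg (smooth_snd M N)).
move=> _ _ [x y] [c [d [Mc Nd ->]]] [c' [d' [Mc' Nd' ->]]] [/= cx dy].
move=> [/= cfx dgy] w.
have [v1 v1w] := subf _ _ _ Mc Mc' cx cfx (lsubmx w).
have [v2 v2w] := subg _ _ _ Nd Nd' dy dgy (rsubmx w).
have dF : differentiable (cto c' \o f \o cof c) (cto c x).
  by have [_ /(_ 1%N)[+ _]] := sf _ _ Mc Mc'; apply; exists x.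
have dG : differentiable (cto d' \o g \o cof d) (cto d y).
  by have [_ /(_ 1%N)[+ _]] := sg _ _ Nd Nd'; apply; exists y.
exists (row_mx v1 v2).
pose L : {linear ('rV[R]_(mdim M') * 'rV[R]_(mdim N'))%type ->
    'rV[R]_(mdim M' + mdim N')} :=
  HB.pack (fun p : 'rV[R]_(mdim M') * 'rV[R]_(mdim N') => row_mx p.1 p.2)
    (GRing.isLinear.Build _ _ _ _ _ (@row_mx_linear _ _)).
have cL : continuous L by exact: continuous_row_mx.
set u := row_mx (cto c x) (cto d y).
have dl : differentiable ((cto c' \o f \o cof c) \o
    (lsubmx : 'rV[R]_(mdim M + mdim N) -> 'rV[R]_(mdim M))) u.
  by apply: differentiable_comp; [exact: differentiable_lsubmx|rewrite row_mxKl].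
have dr : differentiable ((cto d' \o g \o cof d) \o
    (rsubmx : 'rV[R]_(mdim M + mdim N) -> 'rV[R]_(mdim N))) u.
  by apply: differentiable_comp; [exact: differentiable_rsubmx|rewrite row_mxKr].
rewrite -[LHS]/('d (L \o (fun u => (((cto c' \o f \o cof c) \o lsubmx) u,
  ((cto d' \o g \o cof d) \o rsubmx) u))) u (row_mx v1 v2)).
rewrite diff_comp; [|exact: differentiable_pair|exact: linear_differentiable].
rewrite /= (diff_lin _ cL) (diff_pair dl dr) /=.
rewrite diff_comp; [|exact: differentiable_lsubmx|by rewrite row_mxKl].
rewrite diff_comp; [|exact: differentiable_rsubmx|by rewrite row_mxKr].
rewrite /= (diff_lin _ (@continuous_lsubmx _ _ _ _)) (diff_lin _ (@continuous_rsubmx _ _ _ _)).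
by rewrite /= !row_mxKl !row_mxKr v1w v2w hsubmxK.
Qed.

End SmoothMaps.
Arguments smooth_fst {R S T} M N.
Arguments smooth_snd {R S T} M N.

(* ** Lie groupoids *)

(* [gcomp b c] ("b after c") is only meaningful when [src b = tgt c]. *)
Record groupoid := Groupoid {
  ob : Type;
  arr : Type;
  src : arr -> ob;
  tgt : arr -> ob;
  idn : ob -> arr;
  gcomp : arr -> arr -> arr;
  ginv : arr -> arr;
  src_idn : forall x, src (idn x) = x;
  tgt_idn : forall x, tgt (idn x) = x;
  src_gcomp : forall b c, src b = tgt c -> src (gcomp b c) = src c;
  tgt_gcomp : forall b c, src b = tgt c -> tgt (gcomp b c) = tgt b;
  gcomp_idl : forall b, gcomp (idn (tgt b)) b = b;
  gcomp_idr : forall b, gcomp b (idn (src b)) = b;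
  gcompA : forall b c d, src b = tgt c -> src c = tgt d ->
    gcomp b (gcomp c d) = gcomp (gcomp b c) d;
  src_ginv : forall b, src (ginv b) = tgt b;
  tgt_ginv : forall b, tgt (ginv b) = src b;
  gcomp_invl : forall b, gcomp (ginv b) b = idn (src b);
  gcomp_invr : forall b, gcomp b (ginv b) = idn (tgt b) }.

Record gfunctor (X Y : groupoid) := GFunctor {
  gf0 : ob X -> ob Y;
  gf1 : arr X -> arr Y;
  gf_src : forall b, src (gf1 b) = gf0 (src b);
  gf_tgt : forall b, tgt (gf1 b) = gf0 (tgt b);
  gf_idn : forall x, gf1 (idn x) = idn (gf0 x);
  gf_comp : forall b c, src b = tgt c ->
    gf1 (gcomp b c) = gcomp (gf1 b) (gf1 c) }.

(* Composition is required to be smooth on the manifold of composable pairs,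
   expressed through the universal property of this fibre product. *)
Record lie_groupoid (R : realType) := LieGroupoid {
  lg_gpd :> groupoid;
  ob_mf : smooth_structure R (ob lg_gpd);
  arr_mf : smooth_structure R (arr lg_gpd);
  ob_manifold : is_manifold ob_mf;
  arr_manifold : is_manifold arr_mf;
  src_submersion : submersion arr_mf ob_mf (@src lg_gpd);
  tgt_smooth : smooth_map arr_mf ob_mf (@tgt lg_gpd);
  idn_smooth : smooth_map ob_mf arr_mf (@idn lg_gpd);
  inv_smooth : smooth_map arr_mf arr_mf (@ginv lg_gpd);
  comp_smooth : forall (T : Type) (M : smooth_structure R T)
    (p q : T -> arr lg_gpd), smooth_map M arr_mf p -> smooth_map M arr_mf q ->
    (forall t, src (p t) = tgt (q t)) ->
    smooth_map M arr_mf (fun t => gcomp (p t) (q t)) }.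
Arguments ob_mf {R} l.
Arguments arr_mf {R} l.

Record smooth_functor (R : realType) (X Y : lie_groupoid R) := SmoothFunctor {
  sf_fun :> gfunctor X Y;
  sf_smooth0 : smooth_map (ob_mf X) (ob_mf Y) (gf0 sf_fun);
  sf_smooth1 : smooth_map (arr_mf X) (arr_mf Y) (gf1 sf_fun) }.

(* Smooth natural transformations; as Y is a groupoid they are invertible. *)
Record smooth_nat (R : realType) (X Y : lie_groupoid R)
    (F F' : smooth_functor X Y) := SmoothNat {
  sn :> ob X -> arr Y;
  sn_smooth : smooth_map (ob_mf X) (arr_mf Y) sn;
  sn_src : forall x, src (sn x) = gf0 F x;
  sn_tgt : forall x, tgt (sn x) = gf0 F' x;
  sn_nat : forall b,
    gcomp (sn (tgt b)) (gf1 F b) = gcomp (gf1 F' b) (sn (src b)) }.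

Section LieGroupoids.
Context {R : realType}.
Implicit Types X Y Z : lie_groupoid R.

Definition gpd_prod (X Y : groupoid) : groupoid.
Proof.
refine (@Groupoid (ob X * ob Y) (arr X * arr Y)
  (fun b => (src b.1, src b.2)) (fun b => (tgt b.1, tgt b.2))
  (fun x => (idn x.1, idn x.2))
  (fun b c => (gcomp b.1 c.1, gcomp b.2 c.2))
  (fun b => (ginv b.1, ginv b.2)) _ _ _ _ _ _ _ _ _ _ _).
- by move=> [x y]; rewrite /= !src_idn.
- by move=> [x y]; rewrite /= !tgt_idn.
- by move=> [b b'] [c c'] [/= e e']; rewrite !src_gcomp.
- by move=> [b b'] [c c'] [/= e e']; rewrite !tgt_gcomp.
- by move=> [b b']; rewrite /= !gcomp_idl.
- by move=> [b b']; rewrite /= !gcomp_idr.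
- by move=> [b b'] [c c'] [d d'] [/= e e'] [f f']; rewrite !gcompA.
- by move=> [b b']; rewrite /= !src_ginv.
- by move=> [b b']; rewrite /= !tgt_ginv.
- by move=> [b b']; rewrite /= !gcomp_invl.
- by move=> [b b']; rewrite /= !gcomp_invr.
Defined.

Lemma smooth_prod_map S T S' T' (M : smooth_structure R S)
    (N : smooth_structure R T) (M' : smooth_structure R S')
    (N' : smooth_structure R T') (f : S -> S') (g : T -> T') :
  smooth_map M M' f -> smooth_map N N' g ->
  smooth_map (prod_structure M N) (prod_structure M' N')
    (fun p => (f p.1, g p.2)).
Proof.
move=> sf sg; apply: smooth_pair.
  exact: (smooth_comp sf (smooth_fst M N)).
exact: (smooth_comp sg (smooth_snd M N)).
Qed.

Definition lgpd_prod X Y : lie_groupoid R.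
Proof.
refine (@LieGroupoid R (gpd_prod X Y) (prod_structure (ob_mf X) (ob_mf Y))
  (prod_structure (arr_mf X) (arr_mf Y)) _ _ _ _ _ _ _).
- exact: prod_is_manifold (ob_manifold X) (ob_manifold Y).
- exact: prod_is_manifold (arr_manifold X) (arr_manifold Y).
- exact: submersion_prod (src_submersion X) (src_submersion Y).
- exact: smooth_prod_map (@tgt_smooth _ X) (@tgt_smooth _ Y).
- exact: smooth_prod_map (@idn_smooth _ X) (@idn_smooth _ Y).
- exact: smooth_prod_map (@inv_smooth _ X) (@inv_smooth _ Y).
- move=> T M p q sp sq pq; apply: smooth_pair; apply: comp_smooth.
  + exact: (smooth_comp (smooth_fst _ _) sp).
  + exact: (smooth_comp (smooth_fst _ _) sq).
  + by move=> t; case: (pq t).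
  + exact: (smooth_comp (smooth_snd _ _) sp).
  + exact: (smooth_comp (smooth_snd _ _) sq).
  + by move=> t; case: (pq t).
Defined.

Definition sfun_id X : smooth_functor X X.
Proof.
unshelve refine (@SmoothFunctor R X X (@GFunctor X X id id _ _ _ _) _ _) => //.
- exact: smooth_id.
- exact: smooth_id.
Defined.

Definition sfun_comp X Y Z (G : smooth_functor Y Z) (F : smooth_functor X Y) :
  smooth_functor X Z.
Proof.
unshelve refine (@SmoothFunctor R X Z
  (@GFunctor X Z (gf0 G \o gf0 F) (gf1 G \o gf1 F) _ _ _ _) _ _).
- by move=> b; rewrite /= !gf_src.
- by move=> b; rewrite /= !gf_tgt.
- by move=> x; rewrite /= !gf_idn.
- by move=> b c bc; rewrite /= !gf_comp // gf_src gf_tgt bc.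
- exact: smooth_comp (sf_smooth0 G) (sf_smooth0 F).
- exact: smooth_comp (sf_smooth1 G) (sf_smooth1 F).
Defined.

Definition sfun_cst X Y (y : ob Y) : smooth_functor X Y.
Proof.
unshelve refine (@SmoothFunctor R X Y
  (@GFunctor X Y (fun=> y) (fun=> idn y) _ _ _ _) _ _) => //.
- by move=> b; rewrite src_idn.
- by move=> b; rewrite tgt_idn.
- by move=> b c _; rewrite -{2}(tgt_idn y) gcomp_idl.
- exact: smooth_cst.
- exact: smooth_cst.
Defined.

Definition sfun_fst X Y : smooth_functor (lgpd_prod X Y) X.
Proof.
unshelve refine (@SmoothFunctor R (lgpd_prod X Y) X
  (@GFunctor (gpd_prod X Y) X fst fst _ _ _ _) _ _) => //.
- exact: smooth_fst.
- exact: smooth_fst.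
Defined.

Definition sfun_snd X Y : smooth_functor (lgpd_prod X Y) Y.
Proof.
unshelve refine (@SmoothFunctor R (lgpd_prod X Y) Y
  (@GFunctor (gpd_prod X Y) Y snd snd _ _ _ _) _ _) => //.
- exact: smooth_snd.
- exact: smooth_snd.
Defined.

Definition sfun_pair X Y Z (F : smooth_functor X Y) (G : smooth_functor X Z) :
  smooth_functor X (lgpd_prod Y Z).
Proof.
unshelve refine (@SmoothFunctor R X (lgpd_prod Y Z)
  (@GFunctor X (gpd_prod Y Z) (fun x => (gf0 F x, gf0 G x))
    (fun b => (gf1 F b, gf1 G b)) _ _ _ _) _ _).
- by move=> b; rewrite /= !gf_src.
- by move=> b; rewrite /= !gf_tgt.
- by move=> x; rewrite /= !gf_idn.
- by move=> b c bc; rewrite /= !gf_comp.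
- exact: smooth_pair (sf_smooth0 F) (sf_smooth0 G).
- exact: smooth_pair (sf_smooth1 F) (sf_smooth1 G).
Defined.

Definition is_equivalence X Y (F : smooth_functor X Y) : Prop :=
  exists G : smooth_functor Y X,
    inhabited (smooth_nat (sfun_comp G F) (sfun_id X)) /\
    inhabited (smooth_nat (sfun_comp F G) (sfun_id Y)).

End LieGroupoids.

(* ** Coherent Lie 2-groups *)

(* A functor from the one-point groupoid is the same as an object, so the unit
   is given by the object I. *)
Record lie_2group (R : realType) (X : lie_groupoid R) := Lie2Group {
  tg_mul : smooth_functor (lgpd_prod X X) X;
  tg_unit : ob X;
  tg_equiv : is_equivalence (sfun_pair (sfun_fst X X) tg_mul);
  tg_assoc : smooth_nat
    (sfun_comp tg_mul (sfun_pair
      (sfun_comp tg_mul (sfun_fst (lgpd_prod X X) X))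
      (sfun_snd (lgpd_prod X X) X)))
    (sfun_comp tg_mul (sfun_pair
      (sfun_comp (sfun_fst X X) (sfun_fst (lgpd_prod X X) X))
      (sfun_comp tg_mul (sfun_pair
        (sfun_comp (sfun_snd X X) (sfun_fst (lgpd_prod X X) X))
        (sfun_snd (lgpd_prod X X) X)))));
  tg_lunit : smooth_nat
    (sfun_comp tg_mul (sfun_pair (sfun_cst X tg_unit) (sfun_id X)))
    (sfun_id X);
  tg_runit : smooth_nat
    (sfun_comp tg_mul (sfun_pair (sfun_id X) (sfun_cst X tg_unit)))
    (sfun_id X);
  tg_pentagon : forall w x y z : ob X,
    gcomp (gf1 tg_mul (idn w, tg_assoc ((x, y), z)))
      (gcomp (tg_assoc ((w, gf0 tg_mul (x, y)), z))
        (gf1 tg_mul (tg_assoc ((w, x), y), idn z))) =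
    gcomp (tg_assoc ((w, x), gf0 tg_mul (y, z)))
      (tg_assoc ((gf0 tg_mul (w, x), y), z));
  tg_triangle : forall x y : ob X,
    gcomp (gf1 tg_mul (idn x, tg_lunit y)) (tg_assoc ((x, tg_unit), y)) =
    gf1 tg_mul (tg_runit x, idn y) }.

Definition hob (R : realType) (X : lie_groupoid R) (L : lie_2group X)
  (x g : ob X) : ob X := gf0 (tg_mul L) (x, g).

Definition harr (R : realType) (X : lie_groupoid R) (L : lie_2group X)
  (b c : arr X) : arr X := gf1 (tg_mul L) (b, c).

(* ** Action groupoids *)

Record manifold (R : realType) := Manifold {
  mf_carrier :> Type;
  mf_smooth : smooth_structure R mf_carrier;
  mf_manifold : is_manifold mf_smooth }.
Arguments mf_smooth {R} m.

Record lie_group (R : realType) := LieGroup {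
  lie_carrier :> groupType;
  lie_smooth : smooth_structure R lie_carrier;
  lie_manifold : is_manifold lie_smooth;
  lie_mul_smooth : smooth_map (prod_structure lie_smooth lie_smooth) lie_smooth
    (fun p => p.1 * p.2)%g;
  lie_inv_smooth : smooth_map lie_smooth lie_smooth (fun h => h^-1)%g }.
Arguments lie_smooth {R} l.

Record lie_action (R : realType) (H : lie_group R) (G : manifold R) :=
  LieAction {
  act : H -> G -> G;
  act_one : forall g, act 1%g g = g;
  act_mul : forall h h' g, act (h * h')%g g = act h (act h' g);
  act_smooth : smooth_map (prod_structure (lie_smooth H) (mf_smooth G))
    (mf_smooth G) (fun p => act p.1 p.2) }.

Section ActionGroupoid.
Context {R : realType} {H : lie_group R} {G : manifold R}.
Variable A : lie_action H G.

Definition action_gpd : groupoid.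
Proof.
refine (@Groupoid G (H * G)%type snd (fun b => act A b.1 b.2)
  (fun g => (1%g, g)) (fun b c => ((b.1 * c.1)%g, c.2))
  (fun b => (b.1^-1%g, act A b.1 b.2)) _ _ _ _ _ _ _ _ _ _ _) => //=.
- by move=> g; rewrite act_one.
- by move=> [h g] [h' g'] /= ->; rewrite act_mul.
- by move=> [h g]; rewrite /= mul1g.
- by move=> [h g]; rewrite /= mulg1.
- by move=> [h g] [h' g'] [h'' g''] _ _; rewrite /= mulgA.
- by move=> [h g] /=; rewrite -act_mul mulVg act_one.
- by move=> [h g]; rewrite /= mulVg.
- by move=> [h g]; rewrite /= mulgV.
Defined.

Definition action_groupoid : lie_groupoid R.
Proof.
refine (@LieGroupoid R action_gpd (mf_smooth G)
  (prod_structure (lie_smooth H) (mf_smooth G)) _ _ _ _ _ _ _).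
- exact: mf_manifold.
- exact: prod_is_manifold (lie_manifold H) (mf_manifold G).
- exact: submersion_snd.
- exact: act_smooth.
- apply: smooth_pair; [exact: smooth_cst|exact: smooth_id].
- apply: smooth_pair; last exact: act_smooth.
  exact: (smooth_comp (@lie_inv_smooth _ H) (smooth_fst _ _)).
- move=> T M p q sp sq _; apply: smooth_pair; last first.
    exact: (smooth_comp (smooth_snd _ _) sq).
  apply: (smooth_comp (@lie_mul_smooth _ H)
    (f := fun t => ((p t).1, (q t).1))).
  apply: smooth_pair.
    exact: (smooth_comp (smooth_fst _ _) sp).
  exact: (smooth_comp (smooth_fst _ _) sq).
Defined.

End ActionGroupoid.

(* ** Bicategories and pseudofunctors *)

Record category := Category {
  cob :> Type;
  chom : cob -> cob -> Type;
  cid : forall x, chom x x;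
  ccomp : forall x y z, chom y z -> chom x y -> chom x z;
  ccomp_idl : forall x y (f : chom x y), ccomp (cid y) f = f;
  ccomp_idr : forall x y (f : chom x y), ccomp f (cid x) = f;
  ccompA : forall x y z w (f : chom z w) (g : chom y z) (h : chom x y),
    ccomp f (ccomp g h) = ccomp (ccomp f g) h }.
Arguments cid {_} _.

Definition is_iso (C : category) (x y : C) (f : chom x y) : Prop :=
  exists g : chom y x, ccomp g f = cid x /\ ccomp f g = cid y.

Record bicategory := Bicategory {
  bob :> Type;
  bhom : bob -> bob -> category;
  bid : forall a, bhom a a;
  bcomp : forall a b c, bhom b c -> bhom a b -> bhom a c;
  hcomp : forall a b c (f f' : bhom b c) (g g' : bhom a b),
    chom f f' -> chom g g' -> chom (bcomp f g) (bcomp f' g');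
  hcomp_id : forall a b c (f : bhom b c) (g : bhom a b),
    hcomp (cid f) (cid g) = cid (bcomp f g);
  interchange : forall a b c (f f' f'' : bhom b c) (g g' g'' : bhom a b)
    (s' : chom f' f'') (s : chom f f') (t' : chom g' g'') (t : chom g g'),
    hcomp (ccomp s' s) (ccomp t' t) = ccomp (hcomp s' t') (hcomp s t);
  bassoc : forall a b c d (f : bhom c d) (g : bhom b c) (h : bhom a b),
    chom (bcomp (bcomp f g) h) (bcomp f (bcomp g h));
  blunit : forall a b (f : bhom a b), chom (bcomp (bid b) f) f;
  brunit : forall a b (f : bhom a b), chom (bcomp f (bid a)) f;
  bassoc_iso : forall a b c d (f : bhom c d) (g : bhom b c) (h : bhom a b),
    is_iso (bassoc f g h);
  blunit_iso : forall a b (f : bhom a b), is_iso (blunit f);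
  brunit_iso : forall a b (f : bhom a b), is_iso (brunit f);
  bassoc_nat : forall a b c d (f f' : bhom c d) (g g' : bhom b c)
    (h h' : bhom a b) (s : chom f f') (t : chom g g') (u : chom h h'),
    ccomp (bassoc f' g' h') (hcomp (hcomp s t) u) =
    ccomp (hcomp s (hcomp t u)) (bassoc f g h);
  blunit_nat : forall a b (f f' : bhom a b) (s : chom f f'),
    ccomp (blunit f') (hcomp (cid (bid b)) s) = ccomp s (blunit f);
  brunit_nat : forall a b (f f' : bhom a b) (s : chom f f'),
    ccomp (brunit f') (hcomp s (cid (bid a))) = ccomp s (brunit f);
  bpentagon : forall a b c d e (f : bhom d e) (g : bhom c d) (h : bhom b c)
    (k : bhom a b),
    ccomp (hcomp (cid f) (bassoc g h k))
      (ccomp (bassoc f (bcomp g h) k) (hcomp (bassoc f g h) (cid k))) =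
    ccomp (bassoc f g (bcomp h k)) (bassoc (bcomp f g) h k);
  btriangle : forall a b c (f : bhom b c) (g : bhom a b),
    ccomp (hcomp (cid f) (blunit g)) (bassoc f (bid b) g) =
    hcomp (brunit f) (cid g) }.
Arguments bid {_} _.

(* The action on objects [F0] is a parameter, so that the remaining data can be
   compared with given data without transport along equalities of objects. *)
Record pseudofunctor (B C : bicategory) (F0 : B -> C) := Pseudofunctor {
  pf1 : forall a b : B, bhom a b -> bhom (F0 a) (F0 b);
  pf2 : forall (a b : B) (f g : bhom a b), chom f g -> chom (pf1 f) (pf1 g);
  pf_comp : forall (a b c : B) (f : bhom b c) (g : bhom a b),
    chom (bcomp (pf1 f) (pf1 g)) (pf1 (bcomp f g));
  pf_unit : forall a : B, chom (bid (F0 a)) (pf1 (bid a));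
  pf2_id : forall (a b : B) (f : bhom a b), pf2 (cid f) = cid (pf1 f);
  pf2_comp : forall (a b : B) (f g h : bhom a b) (s : chom g h)
    (t : chom f g), pf2 (ccomp s t) = ccomp (pf2 s) (pf2 t);
  pf_comp_iso : forall (a b c : B) (f : bhom b c) (g : bhom a b),
    is_iso (pf_comp f g);
  pf_unit_iso : forall a : B, is_iso (pf_unit a);
  pf_comp_nat : forall (a b c : B) (f f' : bhom b c) (g g' : bhom a b)
    (s : chom f f') (t : chom g g'),
    ccomp (pf_comp f' g') (hcomp (pf2 s) (pf2 t)) =
    ccomp (pf2 (hcomp s t)) (pf_comp f g);
  pf_assoc : forall (a b c d : B) (f : bhom c d) (g : bhom b c)
    (h : bhom a b),
    ccomp (pf2 (bassoc f g h))
      (ccomp (pf_comp (bcomp f g) h) (hcomp (pf_comp f g) (cid (pf1 h)))) =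
    ccomp (pf_comp f (bcomp g h))
      (ccomp (hcomp (cid (pf1 f)) (pf_comp g h))
        (bassoc (pf1 f) (pf1 g) (pf1 h)));
  pf_lunit : forall (a b : B) (f : bhom a b),
    ccomp (pf2 (blunit f))
      (ccomp (pf_comp (bid b) f) (hcomp (pf_unit b) (cid (pf1 f)))) =
    blunit (pf1 f);
  pf_runit : forall (a b : B) (f : bhom a b),
    ccomp (pf2 (brunit f))
      (ccomp (pf_comp f (bid a)) (hcomp (cid (pf1 f)) (pf_unit a))) =
    brunit (pf1 f) }.

(* ** The bicategory BG *)

Section Delooping.
Context {R : realType} {X : lie_groupoid R}.
Variable L : lie_2group X.

Definition garr (x y : ob X) : Type :=
  {b : arr X | src b = x /\ tgt b = y}.

Lemma garr_eq x y (b c : garr x y) : sval b = sval c -> b = c.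
Proof. by move: b c => [b p] [c q] /= bc; exact: eq_exist. Qed.

Definition garr_id (x : ob X) : garr x x :=
  exist _ (idn x) (conj (src_idn x) (tgt_idn x)).

Definition garr_comp (x y z : ob X) (b : garr y z) (c : garr x y) : garr x z.
Proof.
exists (gcomp (sval b) (sval c)).
move: b c => [b [sb tb]] [c [sc tc]] /=.
by rewrite src_gcomp ?tgt_gcomp ?sb ?tc.
Defined.

Definition gpd_cat : category.
Proof.
refine (@Category (ob X) garr garr_id garr_comp _ _ _).
- by move=> x y [b [sb tb]]; apply: garr_eq; rewrite /= -tb gcomp_idl.
- by move=> x y [b [sb tb]]; apply: garr_eq; rewrite /= -sb gcomp_idr.
- move=> x y z w [b [sb tb]] [c [sc tc]] [d [sd td]]; apply: garr_eq => /=.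
  by rewrite gcompA ?sb ?tc ?sc ?td.
Defined.

Definition garr_hcomp (x x' y y' : ob X) (b : garr x x') (c : garr y y') :
  garr (hob L x y) (hob L x' y').
Proof.
exists (harr L (sval b) (sval c)).
move: b c => [b [sb tb]] [c [sc tc]].
by rewrite /harr /= gf_src gf_tgt /= sb sc tb tc.
Defined.

Definition garr_nat (Y : lie_groupoid R) (F F' : smooth_functor Y X)
  (t : smooth_nat F F') (y : ob Y) : garr (gf0 F y) (gf0 F' y) :=
  exist _ (t y) (conj (sn_src t y) (sn_tgt t y)).

Lemma garr_iso (x y : gpd_cat) (b : chom x y) : is_iso b.
Proof.
move: b => [b [sb tb]].
exists (exist _ (ginv b) (conj (etrans (src_ginv b) tb) (etrans (tgt_ginv b) sb))).
by split; apply: garr_eq; rewrite /= ?gcomp_invl ?gcomp_invr ?sb ?tb.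
Qed.

Definition delooping : bicategory.
Proof.
refine (@Bicategory unit (fun _ _ => gpd_cat) (fun=> tg_unit L)
  (fun _ _ _ x y => hob L x y)
  (fun _ _ _ x x' y y' b c => garr_hcomp b c) _ _
  (fun _ _ _ _ x y z => garr_nat (tg_assoc L) ((x, y), z))
  (fun _ _ x => garr_nat (tg_lunit L) x)
  (fun _ _ x => garr_nat (tg_runit L) x) _ _ _ _ _ _ _ _).
- by move=> _ _ _ x y; apply: garr_eq; exact: (gf_idn (tg_mul L) (x, y)).
- move=> _ _ _ x x' x'' y y' y'' [b' [sb' tb']] [b [sb tb]] [c' [sc' tc']]
    [c [sc tc]]; apply: garr_eq; rewrite /= /harr.
  rewrite -(gf_comp (tg_mul L) (b := (b', c')) (c := (b, c))) //.
  by rewrite /= sb' tb sc' tc.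
- by move=> *; exact: garr_iso.
- by move=> *; exact: garr_iso.
- by move=> *; exact: garr_iso.
- move=> _ _ _ _ x x' y y' z z' [b [sb tb]] [c [sc tc]] [d [sd td]].
  subst; apply: garr_eq; exact: (sn_nat (tg_assoc L) ((b, c), d)).
- move=> _ _ x x' [b [sb tb]]; subst; apply: garr_eq.
  exact: (sn_nat (tg_lunit L) b).
- move=> _ _ x x' [b [sb tb]]; subst; apply: garr_eq.
  exact: (sn_nat (tg_runit L) b).
- by move=> _ _ _ _ _ w x y z; apply: garr_eq; exact: tg_pentagon.
- by move=> _ _ _ x y; apply: garr_eq; exact: tg_triangle.
Defined.

End Delooping.

(* ** The 2-category of k-prelinear categories *)

Section TwoVect.
Variable k : fieldType.

Record prelinear := Prelinear {
  pob :> Type;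
  phom : pob -> pob -> lmodType k;
  pid : forall x, phom x x;
  pcomp : forall x y z, phom y z -> phom x y -> phom x z;
  pcomp_idl : forall x y (f : phom x y), pcomp (pid y) f = f;
  pcomp_idr : forall x y (f : phom x y), pcomp f (pid x) = f;
  pcompA : forall x y z w (f : phom z w) (g : phom y z) (h : phom x y),
    pcomp f (pcomp g h) = pcomp (pcomp f g) h;
  pcomp_linearl : forall x y z (g : phom x y),
    linear (fun f : phom y z => pcomp f g);
  pcomp_linearr : forall x y z (f : phom y z),
    linear (fun g : phom x y => pcomp f g) }.

Record lfunctor (C D : prelinear) := LFunctor {
  lf0 :> C -> D;
  lf1 : forall x y, {linear phom x y -> phom (lf0 x) (lf0 y)};
  lf_id : forall x, lf1 x x (pid x) = pid (lf0 x);
  lf_comp : forall x y z (f : phom y z) (g : phom x y),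
    lf1 x z (pcomp f g) = pcomp (lf1 y z f) (lf1 x y g) }.
Arguments lf1 {C D} l {x y}.

Record lnat (C D : prelinear) (F G : lfunctor C D) := LNat {
  ln :> forall x : C, phom (F x) (G x);
  ln_nat : forall x y (f : phom x y),
    pcomp (lf1 G f) (ln x) = pcomp (ln y) (lf1 F f) }.

Lemma lnat_eq (C D : prelinear) (F G : lfunctor C D) (s t : lnat F G) :
  (forall x, s x = t x) -> s = t.
Proof.
case: s t => [s sn] [t tn] /= st; have e : s = t by exact: functional_extensionality_dep.
by rewrite -e in tn *; rewrite (Prop_irrelevance sn tn).
Qed.

Definition lnat_id (C D : prelinear) (F : lfunctor C D) : lnat F F.
Proof.
by refine (@LNat _ _ _ _ (fun x => pid (F x)) _) => x y f; rewrite pcomp_idl pcomp_idr.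
Defined.

Definition lnat_comp (C D : prelinear) (F G H : lfunctor C D) (s : lnat G H)
  (t : lnat F G) : lnat F H.
Proof.
exists (fun x => pcomp (s x) (t x)) => x y f.
by rewrite pcompA ln_nat -pcompA ln_nat pcompA.
Defined.

Definition lfun_cat (C D : prelinear) : category.
Proof.
refine (@Category (lfunctor C D) (@lnat C D) (@lnat_id C D) (@lnat_comp C D)
  _ _ _).
- by move=> F G s; apply: lnat_eq => x; exact: pcomp_idl.
- by move=> F G s; apply: lnat_eq => x; exact: pcomp_idr.
- by move=> F G H K s t u; apply: lnat_eq => x; exact: pcompA.
Defined.

Definition lfun_id (C : prelinear) : lfunctor C C :=
  @LFunctor C C id (fun x y => idfun) (fun=> erefl) (fun _ _ _ _ _ => erefl).

Definition lfun_comp (C D E : prelinear) (F : lfunctor D E) (G : lfunctor C D) :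
  lfunctor C E.
Proof.
refine (@LFunctor C E (F \o G) (fun x y => lf1 F \o lf1 G) _ _).
- by move=> x; rewrite /= !lf_id.
- by move=> x y z f g; rewrite /= !lf_comp.
Defined.

Definition lnat_hcomp (C D E : prelinear) (F F' : lfunctor D E)
  (G G' : lfunctor C D) (s : lnat F F') (t : lnat G G') :
  lnat (lfun_comp F G) (lfun_comp F' G').
Proof.
exists (fun x => pcomp (s (G' x)) (lf1 F (t x))) => x y f /=.
by rewrite pcompA ln_nat -!pcompA -!lf_comp ln_nat.
Defined.

(* 2Vect is strict: the associator and the unitors have identity components. *)
Definition lnat_assoc (B C D E : prelinear) (F : lfunctor D E)
  (G : lfunctor C D) (H : lfunctor B C) :
  lnat (lfun_comp (lfun_comp F G) H) (lfun_comp F (lfun_comp G H)).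
Proof.
refine (@LNat _ _ (lfun_comp (lfun_comp F G) H) (lfun_comp F (lfun_comp G H))
  (fun x => pid (F (G (H x)))) _).
by move=> x y f; rewrite pcomp_idl pcomp_idr.
Defined.

Definition lnat_lunit (C D : prelinear) (F : lfunctor C D) :
  lnat (lfun_comp (lfun_id D) F) F.
Proof.
refine (@LNat _ _ (lfun_comp (lfun_id D) F) F (fun x => pid (F x)) _).
by move=> x y f; rewrite pcomp_idl pcomp_idr.
Defined.

Definition lnat_runit (C D : prelinear) (F : lfunctor C D) :
  lnat (lfun_comp F (lfun_id C)) F.
Proof.
refine (@LNat _ _ (lfun_comp F (lfun_id C)) F (fun x => pid (F x)) _).
by move=> x y f; rewrite pcomp_idl pcomp_idr.
Defined.

Lemma lnat_iso (C D : prelinear) (F G : lfunctor C D) (s : lnat F G)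
  (t : forall x, phom (G x) (F x)) :
  (forall x, pcomp (t x) (s x) = pid (F x)) ->
  (forall x, pcomp (s x) (t x) = pid (G x)) ->
  is_iso (s : @chom (lfun_cat C D) F G).
Proof.
move=> ts st.
have tn x y (f : phom x y) : pcomp (lf1 F f) (t x) = pcomp (t y) (lf1 G f).
  rewrite -[LHS]pcomp_idl -ts -pcompA [X in pcomp _ X]pcompA -ln_nat.
  by rewrite -!pcompA st pcomp_idr.
by exists (LNat tn); split; apply: lnat_eq.
Qed.

Definition TwoVect : bicategory.
Proof.
refine (@Bicategory prelinear lfun_cat lfun_id lfun_comp lnat_hcomp _ _
  lnat_assoc lnat_lunit lnat_runit _ _ _ _ _ _ _ _).
- by move=> C D E F G; apply: lnat_eq => x /=; rewrite lf_id pcomp_idl.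
- move=> C D E F F' F'' G G' G'' s' s t' t; apply: lnat_eq => x /=.
  by rewrite lf_comp -!pcompA; congr pcomp; rewrite !pcompA ln_nat.
- by move=> B C D E F G H;
  apply: (@lnat_iso _ _ _ _ (lnat_assoc F G H) (fun x => pid (F (G (H x))))) => x;
  exact: pcomp_idl.
- by move=> C D F;
  apply: (@lnat_iso _ _ _ _ (lnat_lunit F) (fun x => pid (F x))) => x;
  exact: pcomp_idl.
- by move=> C D F;
  apply: (@lnat_iso _ _ _ _ (lnat_runit F) (fun x => pid (F x))) => x;
  exact: pcomp_idl.
- move=> B C D E F F' G G' H H' s t u; apply: lnat_eq => x /=.
  by rewrite pcomp_idl pcomp_idr lf_comp pcompA.
- by move=> C D F F' s; apply: lnat_eq => x /=; rewrite !pcomp_idl pcomp_idr.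
- by move=> C D F F' s; apply: lnat_eq => x /=; rewrite lf_id !pcomp_idl !pcomp_idr.
- by move=> A B C D E F G H K; apply: lnat_eq => x /=; rewrite !lf_id !pcomp_idl.
- by move=> C D E F G; apply: lnat_eq => x /=; rewrite !lf_id !pcomp_idl.
Defined.

End TwoVect.
Arguments lf1 {k C D} _ {x y}.

(* ** Representations and the category C_V *)

(* Smooth maps into k make sense once k carries a smooth structure for which
   its ring operations are smooth, e.g. the usual ones of the real and complex
   numbers. *)
Record smooth_field (R : realType) (k : fieldType) := SmoothField {
  field_smooth : smooth_structure R k;
  field_add_smooth : smooth_map (prod_structure field_smooth field_smooth)
    field_smooth (fun p => p.1 + p.2);
  field_mul_smooth : smooth_map (prod_structure field_smooth field_smooth)
    field_smooth (fun p => p.1 * p.2) }.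
Arguments field_add_smooth {R k} s.
Arguments field_mul_smooth {R k} s.

(* All matrix coefficients of f are smooth. *)
Definition smooth_End (R : realType) (k : fieldType) (Sk : smooth_field R k)
    (V : vectType k) (T : Type) (M : smooth_structure R T) (f : T -> 'End(V))
    : Prop :=
  forall (v : V) (phi : 'Hom(V, k^o)),
    smooth_map M (field_smooth Sk) (fun t => phi (f t v)).

(* [rep h] is automatically invertible, with inverse [rep h^-1]. *)
Record lie_rep (R : realType) (k : fieldType) (Sk : smooth_field R k)
    (H : lie_group R) (V : vectType k) := LieRep {
  rep :> H -> 'End(V);
  rep_one : rep 1%g = \1%VF;
  rep_mul : forall h h', rep (h * h')%g = (rep h \o rep h')%VF;
  rep_smooth : smooth_End Sk (lie_smooth H) rep }.

Section SmoothEnd.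
Context {R : realType} {k : fieldType} {Sk : smooth_field R k} {V : vectType k}.
Context {T : Type} {M : smooth_structure R T}.
Local Notation smooth_fun := (smooth_map M (field_smooth Sk)).

Lemma smooth_fun_add (f g : T -> k) :
  smooth_fun f -> smooth_fun g -> smooth_fun (fun t => f t + g t).
Proof.
move=> sf sg; exact: (smooth_comp (field_add_smooth Sk) (smooth_pair sf sg)).
Qed.

Lemma smooth_fun_mul (f g : T -> k) :
  smooth_fun f -> smooth_fun g -> smooth_fun (fun t => f t * g t).
Proof.
move=> sf sg; exact: (smooth_comp (field_mul_smooth Sk) (smooth_pair sf sg)).
Qed.

Lemma smooth_fun_sum (I : Type) (r : seq I) (F : I -> T -> k) :
  (forall i, smooth_fun (F i)) -> smooth_fun (fun t => \sum_(i <- r) F i t).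
Proof.
move=> sF; elim: r => [|i r IH].
  rewrite (_ : (fun t => _) = fun=> 0); first exact: smooth_cst.
  by apply/funext => t; rewrite big_nil.
rewrite (_ : (fun t => _) = fun t => F i t + \sum_(j <- r) F j t).
  exact: smooth_fun_add.
by apply/funext => t; rewrite big_cons.
Qed.

Lemma smooth_End_cst (A : 'End(V)) : smooth_End Sk M (fun=> A).
Proof. by move=> v phi; exact: smooth_cst. Qed.

Lemma smooth_End_lin (a : k) (f g : T -> 'End(V)) :
  smooth_End Sk M f -> smooth_End Sk M g ->
  smooth_End Sk M (fun t => a *: f t + g t).
Proof.
move=> sf sg v phi.
rewrite (_ : (fun t => _) = fun t => a * phi (f t v) + phi (g t v)); last first.
  by apply/funext => t; rewrite add_lfunE scale_lfunE linearD linearZ.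
apply: smooth_fun_add; last exact: sg.
by apply: smooth_fun_mul; [exact: smooth_cst|exact: sf].
Qed.

Lemma smooth_End_comp (f g : T -> 'End(V)) :
  smooth_End Sk M f -> smooth_End Sk M g ->
  smooth_End Sk M (fun t => (f t \o g t)%VF).
Proof.
move=> sf sg v phi.
pose b := vbasis {:V}.
pose c i : 'Hom(V, k^o) := linfun (coord b i : V -> k^o).
have fgE t : phi ((f t \o g t)%VF v) =
    \sum_i c i (g t v) * phi (f t b`_i).
  rewrite comp_lfunE {1}(coord_vbasis (memvf (g t v))) !linear_sum.
  by apply: eq_bigr => i _; rewrite !linearZ /c lfunE.
rewrite (funext fgE).
apply: smooth_fun_sum => i.
by apply: smooth_fun_mul; [exact: sg|exact: sf].
Qed.

End SmoothEnd.

Section ImageGroupoid.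
Context {R : realType} {k : fieldType} {Sk : smooth_field R k}.
Context {H : lie_group R} {V : vectType k}.
Variable zeta : lie_rep Sk H V.

Definition rep_image : Type := {A : 'End(V) | exists h, zeta h = A}.

Lemma rep_image_eq (A B : rep_image) : sval A = sval B -> A = B.
Proof. by move: A B => [A p] [B q] /= AB; exact: eq_exist. Qed.

Definition rep_image_id : rep_image := exist _ \1%VF (ex_intro _ _ (rep_one zeta)).

Definition rep_image_comp (A B : rep_image) : rep_image.
Proof.
exists (sval A \o sval B)%VF.
move: A B => [A [h hA]] [B [h' hB]] /=.
by exists (h * h')%g; rewrite rep_mul hA hB.
Defined.

Lemma rep_inv h : (zeta h)^-1%VF = zeta h^-1%g.
Proof.
have k0 : lker (zeta h) == 0%VS.
  apply/lker0P => u v /(congr1 (zeta h^-1%g)).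
  by rewrite -!comp_lfunE -rep_mul mulVg rep_one !id_lfunE.
rewrite -[LHS]comp_lfun1r -(rep_one zeta) -(mulgV h) rep_mul comp_lfunA.
by rewrite lker0_compVf // comp_lfun1l.
Qed.

Definition rep_image_inv (A : rep_image) : rep_image.
Proof.
exists (sval A)^-1%VF.
by move: A => [A [h hA]] /=; exists h^-1%g; rewrite -hA rep_inv.
Defined.

(* The groupoid {V}/zeta(H), with one object V. *)
Definition image_groupoid : groupoid.
Proof.
refine (@Groupoid unit rep_image (fun=> tt) (fun=> tt) (fun=> rep_image_id)
  rep_image_comp rep_image_inv _ _ _ _ _ _ _ _ _ _ _) => //.
- by case.
- by case.
- by move=> b; apply: rep_image_eq; exact: comp_lfun1l.
- by move=> b; apply: rep_image_eq; exact: comp_lfun1r.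
- by move=> b c d _ _; apply: rep_image_eq; exact: comp_lfunA.
- move=> [A [h hA]]; apply: rep_image_eq => /=.
  by rewrite -hA rep_inv -rep_mul mulVg rep_one.
- move=> [A [h hA]]; apply: rep_image_eq => /=.
  by rewrite -hA rep_inv -rep_mul mulgV rep_one.
Defined.

End ImageGroupoid.

Section CV.
Context {R : realType} {k : fieldType} {Sk : smooth_field R k}.
Context {H : lie_group R} {V : vectType k}.
Variables (X : lie_groupoid R) (zeta : lie_rep Sk H V).

(* Objects of C_V: functors rho for which the induced action on the trivial
   bundle over the objects of X with fibre V is smooth. *)
Record cv_ob := CVOb {
  cv_fun :> gfunctor X (image_groupoid zeta);
  cv_smooth : smooth_End Sk (arr_mf X)
    (fun b => sval (gf1 cv_fun b : rep_image zeta)) }.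

Definition cv_act (rho : cv_ob) (b : arr X) : 'End(V) :=
  sval (gf1 rho b : rep_image zeta).

(* Morphisms of C_V: those of the associated representations of X, i.e. smooth
   families of linear maps commuting with the actions. *)
Definition is_cv_hom (rho rho' : cv_ob) (f : ob X -> 'End(V)) : Prop :=
  smooth_End Sk (ob_mf X) f /\
  forall b, (f (tgt b) \o cv_act rho b)%VF = (cv_act rho' b \o f (src b))%VF.

Definition cv_hom_pred (rho rho' : cv_ob) : {pred (ob X -> 'End(V))} :=
  fun f => `[< is_cv_hom rho rho' f >].

Lemma cv_hom_submod rho rho' : submod_closed (cv_hom_pred rho rho').
Proof.
split.
  apply/asboolP; split; first exact: smooth_End_cst.
  by move=> b; rewrite comp_lfun0l comp_lfun0r.
move=> a f g /asboolP[sf nf] /asboolP[sg ng]; apply/asboolP; split.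
  exact: smooth_End_lin.
move=> b; rewrite comp_lfunDl comp_lfunDr -comp_lfunZl -comp_lfunZr.
by rewrite nf ng.
Qed.

HB.instance Definition _ rho rho' :=
  GRing.isSubmodClosed.Build k (ob X -> 'End(V)) (cv_hom_pred rho rho')
    (cv_hom_submod rho rho').

Definition cv_hom (rho rho' : cv_ob) : Type :=
  {f : ob X -> 'End(V) | f \in cv_hom_pred rho rho'}.

HB.instance Definition _ rho rho' := SubType.on (cv_hom rho rho').
HB.instance Definition _ rho rho' := [Choice of cv_hom rho rho' by <:].
HB.instance Definition _ rho rho' :=
  [SubChoice_isSubLmodule of cv_hom rho rho' by <:].

Definition cv_id (rho : cv_ob) : cv_hom rho rho.
Proof.
exists (fun=> \1%VF); apply/asboolP; split; first exact: smooth_End_cst.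
by move=> b; rewrite comp_lfun1l comp_lfun1r.
Defined.

Definition cv_comp (rho1 rho2 rho3 : cv_ob) (f : cv_hom rho2 rho3)
  (g : cv_hom rho1 rho2) : cv_hom rho1 rho3.
Proof.
exists (fun x => val f x \o val g x)%VF.
move: f g => [f /asboolP[sf nf]] [g /asboolP[sg ng]] /=.
apply/asboolP; split; first exact: smooth_End_comp.
by move=> b; rewrite -comp_lfunA ng comp_lfunA nf comp_lfunA.
Defined.

Definition CV : prelinear k.
Proof.
refine (@Prelinear k cv_ob (fun rho rho' => cv_hom rho rho' : lmodType k)
  cv_id cv_comp _ _ _ _ _).
- by move=> rho rho' f; apply/val_inj/funext => x; exact: comp_lfun1l.
- by move=> rho rho' f; apply/val_inj/funext => x; exact: comp_lfun1r.
- by move=> *; apply/val_inj/funext => x; exact: comp_lfunA.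
- move=> r1 r2 r3 g a f f'; apply/val_inj/funext => x.
  by rewrite /= comp_lfunDl -comp_lfunZl.
- move=> r1 r2 r3 f a g g'; apply/val_inj/funext => x.
  by rewrite /= comp_lfunDr -comp_lfunZr.
Defined.

End CV.

Definition cv_app (R : realType) (k : fieldType) (Sk : smooth_field R k)
  (H : lie_group R) (V : vectType k) (X : lie_groupoid R)
  (zeta : lie_rep Sk H V) (rho rho' : CV X zeta) (f : phom rho rho') :
  ob X -> 'End(V) := val f.

(* 2-representations of a Lie 2-group sending the object of BG to C. *)
Definition two_rep (R : realType) (X : lie_groupoid R) (L : lie_2group X)
  (k : fieldType) (C : prelinear k) : Type :=
  @pseudofunctor (delooping L) (TwoVect k) (fun _ => C).

Section TwoRepData.
Context {R : realType} {X : lie_groupoid R} {L : lie_2group X}.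
Context {k : fieldType} {C : prelinear k}.
Variable F : two_rep L C.

Definition two_rep_ob (g : ob X) : lfunctor C C := pf1 F (a := tt) (b := tt) g.

Definition two_rep_arr (g g' : ob X) (b : garr g g') :
  lnat (two_rep_ob g) (two_rep_ob g') := pf2 F (a := tt) (b := tt) b.

Definition two_rep_comp (g g' : ob X) :
  lnat (lfun_comp (two_rep_ob g) (two_rep_ob g')) (two_rep_ob (hob L g g')) :=
  pf_comp F (a := tt) (b := tt) (c := tt) g g'.

Definition two_rep_unit : lnat (lfun_id C) (two_rep_ob (tg_unit L)) :=
  pf_unit F tt.

End TwoRepData.

(* Main.v *)
Require Import Defs.
From HB Require Import structures.
From mathcomp Require Import all_boot all_order all_algebra.
From mathcomp Require Import all_classical all_reals all_analysis.

Set Implicit Arguments.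
Unset Strict Implicit.
Unset Printing Implicit Defensive.
Local Open Scope ring_scope.

(** Right translation by an object g is a smooth endofunctor x |-> x g of the
    groupoid X.  An arrow g -> g' gives a smooth natural transformation between
    two such functors, and so do the associator, (x g) g' -> x (g g'), and the
    right unitor, x I -> x.  Functors into {V}/zeta(H) can be pulled back:
    precomposition with F : X -> Y is a linear functor C_V(Y) -> C_V(X), and a
    smooth natural transformation t : F => F' yields the family rho(t_x), which
    is a morphism F^* rho -> F'^* rho because rho is a functor, is natural in
    rho because morphisms of C_V commute with the actions, and is invertible
    because t is.  So everything in the asserted data is a pullback
    ([pull], [pull_nat], [pull_nat_iso]).  Pulling back by g' and then by g is
    pulling back along x |-> (x g) g', which is why right translations give a
    covariant pseudofunctor.

    The axioms of a pseudofunctor then follow by applying rho to identities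
    between arrows of X.  Functoriality and naturality of the comparison cells
    are the interchange law and naturality of the associator; associativity is
    the pentagon at (x, f, g, h); the left unit axiom is the triangle at (x, g).
    The right unit axiom is not among the given coherence laws: it reads
    (1_x . r_g) a_(x,g,I) = r_(x g), which is Kelly's redundant unit axiom
    ([brunit_bcomp]) and is deduced from the pentagon and the triangle. *)

(** * Kelly's unit coherence in a bicategory *)

Section BicategoryCoherence.
Variable B : bicategory.

(** Naturality of the right unitor exhibits s as a conjugate of s whiskered
    with the identity 1-cell. *)
Lemma hcomp_bid_inj (a b : B) (f g : bhom a b) (s t : chom f g) :
  hcomp s (Defs.cid (bid a)) = hcomp t (Defs.cid (bid a)) -> s = t.
Proof.
move=> st; have [r [_ fr]] := brunit_iso f.
by rewrite -[s]ccomp_idr -[t]ccomp_idr -fr !ccompA -!brunit_nat st.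
Qed.

(** Kelly's argument: it suffices to compare both sides after whiskering with
    an identity 1-cell and composing with an associator.  There the triangle
    turns unitors whiskered on the right into left unitors, and the pentagon for
    f, g and two identity 1-cells identifies what remains. *)
Lemma brunit_bcomp (a b c : B) (f : bhom b c) (g : bhom a b) :
  ccomp (hcomp (Defs.cid f) (brunit g)) (bassoc f g (bid a)) =
  brunit (bcomp f g).
Proof.
apply: hcomp_bid_inj; have [i [ia _]] := bassoc_iso f g (bid a).
suff : ccomp (bassoc f g (bid a)) (hcomp (ccomp (hcomp (Defs.cid f) (brunit g))
    (bassoc f g (bid a))) (Defs.cid (bid a))) =
  ccomp (bassoc f g (bid a)) (hcomp (brunit (bcomp f g)) (Defs.cid (bid a))).
  by move/(congr1 (ccomp i)); rewrite !ccompA ia !ccomp_idl.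
rewrite -[Defs.cid (bid a) in LHS](ccomp_idl (Defs.cid _)) Defs.interchange ccompA.
rewrite bassoc_nat -btriangle -[Defs.cid f in LHS](ccomp_idl (Defs.cid _)).
rewrite Defs.interchange -!ccompA bpentagon -btriangle !ccompA; congr ccomp.
by rewrite -hcomp_id bassoc_nat.
Qed.

End BicategoryCoherence.

(** * Inverting smooth natural transformations *)

Section NaturalTransformations.
Context {R : realType} {X Y : lie_groupoid R}.
Context {F F' : smooth_functor X Y}.

Definition snat_inv (t : smooth_nat F F') : smooth_nat F' F.
Proof.
refine (@SmoothNat R X Y F' F (fun x => ginv (t x)) _ _ _ _).
- exact: (smooth_comp (@inv_smooth _ Y) (sn_smooth t)).
- by move=> x; rewrite src_ginv sn_tgt.
- by move=> x; rewrite tgt_ginv sn_src.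
- move=> b.
  (* Write F' b as (F' b) t t^-1, move t past b by naturality of t, and cancel
     t on the left. *)
  rewrite -[X in gcomp _ X = _]gcomp_idr gf_src -(sn_tgt t) -gcomp_invr.
  rewrite (@gcompA _ (gf1 F' b)) ?gf_src ?sn_tgt ?tgt_ginv ?sn_src //.
  rewrite -(sn_nat t) -(@gcompA _ (t (tgt b)))
    ?sn_src ?gf_tgt ?gf_src ?tgt_ginv ?sn_src //.
  rewrite gcompA ?src_ginv ?tgt_gcomp ?gf_tgt ?gf_src ?tgt_ginv ?sn_src //.
  rewrite gcomp_invl sn_src -gf_tgt.
  by rewrite -[X in idn X](@tgt_gcomp _ (gf1 F b) (ginv (t (src b)))) ?gcomp_idl
    // tgt_ginv sn_src gf_src.
Defined.

End NaturalTransformations.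

(** * Right translations of a Lie 2-group *)

Lemma gcomp_idn (Y : groupoid) (x : ob Y) : gcomp (idn x) (idn x) = idn x.
Proof. by rewrite -{1}(tgt_idn x) gcomp_idl. Qed.

Section Multiplication.
Context {R : realType} {X : lie_groupoid R} (L : lie_2group X).

Lemma src_harr b c : src (harr L b c) = hob L (src b) (src c).
Proof. exact: (gf_src (tg_mul L) (b, c)). Qed.

Lemma tgt_harr b c : tgt (harr L b c) = hob L (tgt b) (tgt c).
Proof. exact: (gf_tgt (tg_mul L) (b, c)). Qed.

Lemma harr_idn x y : harr L (idn x) (idn y) = idn (hob L x y).
Proof. exact: (gf_idn (tg_mul L) (x, y)). Qed.

Lemma harr_gcomp b b' c c' : src b = tgt b' -> src c = tgt c' ->
  harr L (gcomp b b') (gcomp c c') = gcomp (harr L b c) (harr L b' c').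
Proof.
move=> eb ec; rewrite -(gf_comp (tg_mul L) (b := (b, c)) (c := (b', c'))) //.
by rewrite /= eb ec.
Qed.

Lemma runit_hob x y :
  gcomp (harr L (idn x) (tg_runit L y)) (tg_assoc L ((x, y), tg_unit L)) =
  tg_runit L (hob L x y).
Proof. exact: (congr1 sval (@brunit_bcomp (delooping L) tt tt tt x y)). Qed.

Definition rtrans (g : ob X) : smooth_functor X X :=
  sfun_comp (tg_mul L) (sfun_pair (sfun_id X) (sfun_cst X g)).

Definition rtrans_arr g g' (b : garr g g') :
  smooth_nat (rtrans g) (rtrans g').
Proof.
refine (@SmoothNat R X X (rtrans g) (rtrans g')
  (fun x => harr L (idn x) (sval b)) _ _ _ _); move: b => [b [sb tb]] /=.
- apply: (smooth_comp (sf_smooth1 (tg_mul L)) (f := fun x => (idn x, b))).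
  by apply: smooth_pair; [exact: idn_smooth|exact: smooth_cst].
- by move=> x; rewrite src_harr src_idn sb.
- by move=> x; rewrite tgt_harr tgt_idn tb.
- move=> c; rewrite -!/(harr _ _ _) -!harr_gcomp ?src_idn ?tgt_idn //.
  by rewrite gcomp_idl gcomp_idr -sb -tb gcomp_idl gcomp_idr.
Defined.

Definition rtrans_comp g g' :
  smooth_nat (sfun_comp (rtrans g') (rtrans g)) (rtrans (hob L g g')).
Proof.
refine (@SmoothNat R X X (sfun_comp (rtrans g') (rtrans g))
  (rtrans (hob L g g')) (fun x => tg_assoc L ((x, g), g')) _ _ _ _).
- apply: (smooth_comp (sn_smooth (tg_assoc L)) (f := fun x => ((x, g), g'))).
  apply: smooth_pair; last exact: smooth_cst.
  by apply: smooth_pair; [exact: smooth_id|exact: smooth_cst].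
- by move=> x; rewrite sn_src.
- by move=> x; rewrite sn_tgt.
- move=> c; have := sn_nat (tg_assoc L) ((c, idn g), idn g').
  by rewrite /= !src_idn !tgt_idn -!/(harr _ _ _) harr_idn.
Defined.

End Multiplication.

(** * The action maps and morphisms of C_V *)

Section RepresentationCategory.
Context {R : realType} {k : fieldType} {Sk : smooth_field R k}.
Context {H : lie_group R} {V : vectType k} {X : lie_groupoid R}.
Context {zeta : lie_rep Sk H V}.
Implicit Types (rho : CV X zeta).

Lemma cv_act_idn rho x : cv_act rho (idn x) = \1%VF.
Proof. by rewrite /cv_act gf_idn. Qed.

Lemma cv_act_gcomp rho b c : src b = tgt c ->
  cv_act rho (gcomp b c) = (cv_act rho b \o cv_act rho c)%VF.
Proof. by move=> bc; rewrite /cv_act gf_comp. Qed.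

Lemma cv_act_ginv rho b : cv_act rho (ginv b) = (cv_act rho b)^-1%VF.
Proof.
have VK : (cv_act rho (ginv b) \o cv_act rho b)%VF = \1%VF.
  by rewrite -cv_act_gcomp ?src_ginv // gcomp_invl cv_act_idn.
have KV : (cv_act rho b \o cv_act rho (ginv b))%VF = \1%VF.
  by rewrite -cv_act_gcomp ?tgt_ginv // gcomp_invr cv_act_idn.
have k0 : lker (cv_act rho b) == 0%VS.
  apply/lker0P => u v /(congr1 (cv_act rho (ginv b))).
  by rewrite -!comp_lfunE VK !id_lfunE.
by rewrite -[RHS]comp_lfun1r -KV comp_lfunA lker0_compVf // comp_lfun1l.
Qed.

Lemma cv_hom_eq rho rho' (f g : phom rho rho') :
  (forall x, cv_app f x = cv_app g x) -> f = g.
Proof. by move=> fg; apply/val_inj/funext. Qed.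

Lemma cv_app_smooth rho rho' (f : phom rho rho') :
  smooth_End Sk (ob_mf X) (cv_app f).
Proof. by have /asboolP[] := valP (f : cv_hom rho rho'). Qed.

Lemma cv_app_nat rho rho' (f : phom rho rho') b :
  (cv_app f (tgt b) \o cv_act rho b)%VF = (cv_act rho' b \o cv_app f (src b))%VF.
Proof. by have /asboolP[_ ->] := valP (f : cv_hom rho rho'). Qed.

Lemma cv_app_pid rho x : cv_app (pid rho) x = \1%VF.
Proof. by []. Qed.

Lemma cv_app_pcomp rho1 rho2 rho3 (f : phom rho2 rho3) (g : phom rho1 rho2) x :
  cv_app (Defs.pcomp f g) x = (cv_app f x \o cv_app g x)%VF.
Proof. by []. Qed.

Definition cv_mk rho rho' (f : ob X -> 'End(V)) (hf : is_cv_hom rho rho' f) :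
  phom rho rho' := exist _ f (asboolT hf).

End RepresentationCategory.

(** * Pulling back along smooth functors and transformations *)

Section Pullback.
Context {R : realType} {k : fieldType} {Sk : smooth_field R k}.
Context {H : lie_group R} {V : vectType k} {zeta : lie_rep Sk H V}.
Implicit Types X Y Z : lie_groupoid R.

Lemma smooth_End_precomp S T (M : smooth_structure R S)
    (N : smooth_structure R T) (f : T -> 'End(V)) (g : S -> T) :
  smooth_End Sk N f -> smooth_map M N g -> smooth_End Sk M (f \o g).
Proof. by move=> sf sg v phi; exact: (smooth_comp (sf v phi) sg). Qed.

Section PullbackFunctor.
Context {X Y : lie_groupoid R} (F : smooth_functor X Y).

Definition pull_fun (rho : CV Y zeta) : gfunctor X (image_groupoid zeta).
Proof.
refine (@GFunctor X (image_groupoid zeta) (gf0 rho \o gf0 F) (gf1 rho \o gf1 F)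
  _ _ _ _).
- by move=> b; rewrite [LHS](gf_src rho) gf_src.
- by move=> b; rewrite [LHS](gf_tgt rho) gf_tgt.
- by move=> x; rewrite /= !gf_idn.
- by move=> b c bc; rewrite /= !gf_comp // gf_src gf_tgt bc.
Defined.

Definition pull_ob (rho : CV Y zeta) : CV X zeta :=
  CVOb (cv_fun := pull_fun rho)
    (smooth_End_precomp (cv_smooth rho) (sf_smooth1 F)).

Lemma pull_is_cv_hom (rho rho' : CV Y zeta) (f : phom rho rho') :
  is_cv_hom (pull_ob rho) (pull_ob rho') (cv_app f \o gf0 F).
Proof.
split; first exact: smooth_End_precomp (cv_app_smooth f) (sf_smooth0 F).
by move=> b; have := cv_app_nat f (gf1 F b); rewrite gf_src gf_tgt.
Qed.

Definition pull_hom (rho rho' : CV Y zeta) (f : phom rho rho') :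
  phom (pull_ob rho) (pull_ob rho') := cv_mk (pull_is_cv_hom f).

Lemma pull_hom_linear rho rho' : linear (@pull_hom rho rho').
Proof. by move=> a f f'; exact: cv_hom_eq. Qed.

HB.instance Definition _ rho rho' :=
  GRing.isLinear.Build k _ _ _ (@pull_hom rho rho') (@pull_hom_linear rho rho').

Definition pull : lfunctor (CV Y zeta) (CV X zeta).
Proof.
refine (@LFunctor _ _ (CV X zeta) pull_ob (fun rho rho' => @pull_hom rho rho') _ _).
- by move=> rho; exact: cv_hom_eq.
- by move=> rho1 rho2 rho3 f f'; exact: cv_hom_eq.
Defined.

End PullbackFunctor.

(** A composite of pullbacks, and the identity functor, act as pullbacks along
    the composite and identity groupoid functors, but they are not equal to
    [pull] of these up to conversion, since the objects of C_V carry proofs.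
    Specifying pullbacks by their values lets one construction of
    transformations serve for all of them. *)
Definition is_pull X Y (F : smooth_functor X Y)
    (P : lfunctor (CV Y zeta) (CV X zeta)) : Prop :=
  (forall rho b, cv_act (P rho) b = cv_act rho (gf1 F b)) /\
  (forall rho rho' (f : phom rho rho') x,
    cv_app (lf1 P f) x = cv_app f (gf0 F x)).

Lemma is_pull_pull X Y (F : smooth_functor X Y) : is_pull F (pull F).
Proof. by []. Qed.

Lemma is_pull_id X : is_pull (sfun_id X) (lfun_id (CV X zeta)).
Proof. by []. Qed.

Lemma is_pull_comp X Y Z (F : smooth_functor X Y) (G : smooth_functor Y Z) P Q :
  is_pull F P -> is_pull G Q -> is_pull (sfun_comp G F) (lfun_comp P Q).
Proof.
move=> [Pa Ph] [Qa Qh]; split=> [rho b|rho rho' f x].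
  by rewrite [LHS]Pa Qa.
by rewrite [LHS]Ph Qh.
Qed.

Section PullbackTransformation.
Context {X Y : lie_groupoid R} {F F' : smooth_functor X Y}.
Context {P P' : lfunctor (CV Y zeta) (CV X zeta)}.
Hypotheses (FP : is_pull F P) (FP' : is_pull F' P').

Lemma pull_nat_is_cv_hom (t : smooth_nat F F') rho :
  is_cv_hom (P rho) (P' rho) (fun x => cv_act rho (t x)).
Proof.
split; first exact: smooth_End_precomp (cv_smooth rho) (sn_smooth t).
move=> b; rewrite FP.1 FP'.1 -!cv_act_gcomp ?sn_src ?sn_tgt ?gf_src ?gf_tgt //.
by rewrite sn_nat.
Qed.

Definition pull_nat (t : smooth_nat F F') : lnat P P'.
Proof.
refine (@LNat _ _ _ P P' (fun rho => cv_mk (pull_nat_is_cv_hom t rho)) _).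
move=> rho rho' f; apply: cv_hom_eq => x; have := cv_app_nat f (t x).
by rewrite !cv_app_pcomp FP.2 FP'.2 sn_src sn_tgt => ->.
Defined.

End PullbackTransformation.

Lemma cv_app_pull_nat X Y (F F' : smooth_functor X Y) P P'
    (FP : is_pull F P) (FP' : is_pull F' P') (t : smooth_nat F F') rho x :
  cv_app (pull_nat FP FP' t rho) x = cv_act rho (t x).
Proof. by []. Qed.

Lemma pull_nat_iso X Y (F F' : smooth_functor X Y) P P'
    (FP : is_pull F P) (FP' : is_pull F' P') (t : smooth_nat F F') :
  @is_iso (lfun_cat (CV Y zeta) (CV X zeta)) P P' (pull_nat FP FP' t).
Proof.
apply: (lnat_iso (t := pull_nat FP' FP (snat_inv t))) => rho;
  apply: cv_hom_eq => x; rewrite cv_app_pcomp !cv_app_pull_nat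
    -cv_act_gcomp ?src_ginv ?tgt_ginv //.
  by rewrite gcomp_invl cv_act_idn.
by rewrite gcomp_invr cv_act_idn.
Qed.

End Pullback.

(** * The 2-representation by right translations *)

Section TwoRepresentation.
Context {R : realType} {k : fieldType} {Sk : smooth_field R k}.
Context {H : lie_group R} {V : vectType k} {X : lie_groupoid R}.
Context (L : lie_2group X) (zeta : lie_rep Sk H V).
Local Notation C := (CV X zeta).
Let trans g : lfunctor C C := pull (rtrans L g).
Let trans_pull g : is_pull (rtrans L g) (trans g) :=
  is_pull_pull (rtrans L g).

Let trans_arr g g' (b : garr g g') : lnat (trans g) (trans g') :=
  pull_nat (trans_pull g) (trans_pull g') (rtrans_arr L b).

Let trans_comp g g' : lnat (lfun_comp (trans g) (trans g')) (trans (hob L g g')) :=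
  pull_nat (is_pull_comp (trans_pull g) (trans_pull g')) (trans_pull (hob L g g'))
    (rtrans_comp L g g').

Let trans_unit : lnat (lfun_id C) (trans (tg_unit L)) :=
  pull_nat (is_pull_id X) (trans_pull (tg_unit L)) (snat_inv (tg_runit L)).

(** In each axiom the two sides are compared at an object rho of C_V and an
    object x of X.  They unfold to composites of maps rho(b) with b an arrow
    of X, up to identities coming from the strict structure of the target;
    functoriality of rho turns them into a single rho(b). *)
Definition translation_rep : two_rep L C.
Proof.
refine (@Pseudofunctor (delooping L) (TwoVect k) (fun=> C)
  (fun _ _ => trans) (fun _ _ => trans_arr) (fun _ _ _ => trans_comp)
  (fun=> trans_unit) _ _ _ _ _ _ _ _).
- move=> u v g; apply: lnat_eq => rho; apply: cv_hom_eq => x.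
  rewrite -[LHS]/(cv_act rho (harr L (idn x) (idn g))).
  by rewrite harr_idn cv_act_idn.
- move=> u v g g' g'' [b [sb tb]] [c [sc tc]].
  apply: lnat_eq => rho; apply: cv_hom_eq => x.
  rewrite -[LHS]/(cv_act rho (harr L (idn x) (gcomp b c))).
  rewrite -[RHS]/(cv_act rho (harr L (idn x) b) \o
                  cv_act rho (harr L (idn x) c))%VF.
  rewrite -{1}[idn x]gcomp_idn harr_gcomp ?src_idn ?tgt_idn ?sb ?tc //.
  by rewrite cv_act_gcomp // src_harr tgt_harr src_idn tgt_idn sb tc.
- by move=> *; exact: pull_nat_iso.
- by move=> *; exact: pull_nat_iso.
- move=> u v w f f' g g' [b [sb tb]] [c [sc tc]].
  apply: lnat_eq => rho; apply: cv_hom_eq => x.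
  rewrite -[LHS]/(cv_act rho (tg_assoc L ((x, f'), g')) \o
    (cv_act rho (harr L (harr L (idn x) b) (idn g')) \o
     cv_act rho (harr L (idn (hob L x f)) c)))%VF.
  rewrite -[RHS]/(cv_act rho (harr L (idn x) (harr L b c)) \o
    cv_act rho (tg_assoc L ((x, f), g)))%VF.
  rewrite -!cv_act_gcomp ?src_gcomp ?tgt_gcomp ?src_harr ?tgt_harr
    ?src_idn ?tgt_idn ?sn_src ?sn_tgt ?sb ?tb ?sc ?tc //.
  (* Interchange merges the two whiskered cells into (1_x . b) . c, to which
     naturality of the associator applies. *)
  rewrite -harr_gcomp ?src_harr ?tgt_idn ?src_idn ?sb //.
  have -> : gcomp (harr L (idn x) b) (idn (hob L x f)) = harr L (idn x) b.
    have <- : src (harr L (idn x) b) = hob L x f by rewrite src_harr src_idn sb.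
    exact: gcomp_idr.
  rewrite -tc gcomp_idl.
  have := sn_nat (tg_assoc L) ((idn x, b), c).
  by rewrite /= !src_idn !tgt_idn sb tb sc => <-; rewrite tc.
- move=> u v w z f g h; apply: lnat_eq => rho; apply: cv_hom_eq => x.
  rewrite -[LHS]/(cv_act rho (harr L (idn x) (tg_assoc L ((f, g), h))) \o
    (cv_act rho (tg_assoc L ((x, hob L f g), h)) \o
     (cv_act rho (harr L (tg_assoc L ((x, f), g)) (idn h)) \o \1)))%VF.
  rewrite -[RHS]/(cv_act rho (tg_assoc L ((x, f), hob L g h)) \o
    ((\1 \o cv_act rho (tg_assoc L ((hob L x f, g), h))) \o \1))%VF.
  rewrite !comp_lfun1r comp_lfun1l.
  rewrite -!cv_act_gcomp ?src_gcomp ?tgt_gcomp ?src_harr ?tgt_harr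
    ?src_idn ?tgt_idn ?sn_src ?sn_tgt //.
  by rewrite /harr tg_pentagon.
- move=> u v g; apply: lnat_eq => rho; apply: cv_hom_eq => x.
  rewrite -[LHS]/(cv_act rho (harr L (idn x) (tg_lunit L g)) \o
    (cv_act rho (tg_assoc L ((x, tg_unit L), g)) \o
     (cv_act rho (harr L (ginv (tg_runit L x)) (idn g)) \o \1)))%VF.
  rewrite -[RHS]/(\1)%VF.
  rewrite comp_lfun1r comp_lfunA -!cv_act_gcomp ?src_gcomp ?tgt_gcomp
    ?src_harr ?tgt_harr ?src_ginv ?tgt_ginv ?src_idn ?tgt_idn ?sn_src ?sn_tgt //.
  rewrite [X in gcomp X _]tg_triangle -/(harr _ _ _).
  rewrite -harr_gcomp ?tgt_ginv ?src_idn ?tgt_idn //.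
  by rewrite gcomp_invr gcomp_idn harr_idn cv_act_idn.
- move=> u v g; apply: lnat_eq => rho; apply: cv_hom_eq => x.
  rewrite -[LHS]/(cv_act rho (harr L (idn x) (tg_runit L g)) \o
    (cv_act rho (tg_assoc L ((x, g), tg_unit L)) \o
     (\1 \o cv_act rho (ginv (tg_runit L (hob L x g))))))%VF.
  rewrite -[RHS]/(\1)%VF.
  rewrite comp_lfun1l comp_lfunA -!cv_act_gcomp ?src_gcomp ?tgt_gcomp
    ?src_harr ?tgt_harr ?src_ginv ?tgt_ginv ?src_idn ?tgt_idn ?sn_src ?sn_tgt //.
  by rewrite runit_hob gcomp_invr cv_act_idn.
Defined.

End TwoRepresentation.

Theorem corollary2 (R : realType)
    (k : fieldType) (char0 : [pchar k] =i pred0) (Sk : smooth_field R k)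
    (H : lie_group R) (G : manifold R) (A : lie_action H G)
    (L : lie_2group (action_groupoid A))
    (V : vectType k) (zeta : lie_rep Sk H V) :
  exists F : two_rep L (CV (action_groupoid A) zeta),
  [/\ forall (g : ob (action_groupoid A)) (rho : CV (action_groupoid A) zeta),
        (forall x : ob (action_groupoid A),
          gf0 (two_rep_ob F g rho) x = gf0 rho (hob L x g)) /\
        (forall b : arr (action_groupoid A),
          gf1 (two_rep_ob F g rho) b = gf1 rho (harr L b (idn g))),
      forall (g : ob (action_groupoid A)) (rho rho' : CV (action_groupoid A) zeta)
          (f : phom rho rho') (x : ob (action_groupoid A)),
        cv_app (lf1 (two_rep_ob F g) f) x = cv_app f (hob L x g),
      forall (g0 g0' : ob (action_groupoid A)) (g1 : garr g0 g0')
          (rho : CV (action_groupoid A) zeta) (x : ob (action_groupoid A)),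
        cv_app (two_rep_arr F g1 rho) x =
        cv_act rho (harr L (idn x) (sval g1)),
      forall (g g' : ob (action_groupoid A)) (rho : CV (action_groupoid A) zeta) (x : ob (action_groupoid A)),
        cv_app (two_rep_comp F g g' rho) x =
        cv_act rho (tg_assoc L ((x, g), g')) &
      forall (rho : CV (action_groupoid A) zeta) (x : ob (action_groupoid A)),
        cv_app (two_rep_unit F rho) x =
        ((cv_act rho (tg_runit L x))^-1)%VF].
Proof.
exists (translation_rep L zeta); split=> // rho x.
exact: cv_act_ginv.
Qed.
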